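(* The dimension of the reduced cohomology $H^q(\widetilde{\mathcal{SV}},\mathbb{C})$ of the extended Schrödinger-Virasoro conformal algebra with trivial coefficients ($q\in\mathbb{Z}_+$) is $$\dim H^q(\widetilde{\mathcal{SV}},\mathbb{C})=\begin{cases}1 & \text{if } q=0,\\ 3 & \text{if } q=2,\\ 5 & \text{if } q=3,\\ 2 & \text{if } q=4,\\ 0 & \text{otherwise.}\end{cases}$$
   Context: All vector spaces are over $\mathbb{C}$; $\mathbb{Z}_+$ is the set of nonnegative integers. Lie conformal algebra: a $\mathbb{C}[\partial]$-module $\mathcal{A}$ with a $\mathbb{C}$-bilinear map $\mathcal{A}\otimes\mathcal{A}\to\mathbb{C}[\lambda]\otimes\mathcal{A}$, $a\otimes b\mapsto[a_\lambda b]$, satisfying $[\partial a_\lambda b]=-\lambda[a_\lambda b]$, $[a_\lambda\partial b]=(\partial+\lambda)[a_\lambda b]$, $[a_\lambda b]=-[b_{-\lambda-\partial}a]$, and $[a_\lambda[b_\mu c]]=[[a_\lambda b]_{\lambda+\mu}c]+[b_\mu[a_\lambda c]]$. The extended Schrödinger-Virasoro conformal algebra $\widetilde{\mathcal{SV}}$ is the Lie conformal algebra that is the free $\mathbb{C}[\partial]$-module on $L,N,Y,M$ with $[L_\lambda L]=(\partial+2\lambda)L$, $[L_\lambda Y]=(\partial+\frac32\lambda)Y$, $[L_\lambda M]=(\partial+\lambda)M$, $[L_\lambda N]=(\partial+\lambda)N$, $[Y_\lambda Y]=(\partial+2\lambda)M$, $[N_\lambda Y]=Y$, $[N_\lambda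 M]=2M$; the brackets in the opposite order are determined by skew-symmetry, and all other brackets of generators are zero. Basic complex with trivial coefficients $\mathbb{C}$ (on which $\partial$ and all $a_\lambda$ act as zero): an $n$-cochain is a $\mathbb{C}$-linear map $\gamma:\mathcal{A}^{\otimes n}\to\mathbb{C}[\lambda_1,\dots,\lambda_n]$, $a_1\otimes\cdots\otimes a_n\mapsto\gamma_{\lambda_1,\dots,\lambda_n}(a_1,\dots,a_n)$, such that (1) $\gamma_{\lambda_1,\dots,\lambda_n}(a_1,\dots,\partial a_i,\dots,a_n)=-\lambda_i\gamma_{\lambda_1,\dots,\lambda_n}(a_1,\dots,a_n)$, and (2) $\gamma$ is skew-symmetric under simultaneous permutations of the $a_i$'s and the $\lambda_i$'s. The space of $n$-cochains is $\widetilde{C}^n(\mathcal{A},\mathbb{C})$, with $\widetilde{C}^0(\mathcal{A},\mathbb{C})=\mathbb{C}$. The differential is $d_0=0$ and, for $n\ge1$, $$(d_n\gamma)_{\lambda_1,\dots,\lambda_{n+1}}(a_1,\dots,a_{n+1})=\sum_{1\le i<j\le n+1}(-1)^{i+j}\gamma_{\lambda_i+\lambda_j,\lambda_1,\dots,\hat{\lambda_i},\dots,\hat{\lambda_j},\dots,\lambda_{n+1}}([a_{i\,\lambda_i}a_j],a_1,\dots,\hat{a_i},\dots,\hat{a_j},\dots,a_{n+1}),$$ where $\gamma$ is extended linearly over polynomials in the $\lambda_i$; $d^2=0$. Reduced cohomology: $\partial$ acts on $\widetilde{C}^n(\mathcal{A},\mathbb{C})$ by $(\partial\gamma)_{\lambda_1,\dots,\lambda_n}=(\sum_{i=1}^n\lambda_i)\gamma_{\lambda_1,\dots,\lambda_n}$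 (zero for $n=0$) and commutes with $d$. The reduced complex is the quotient complex $\widetilde{C}^\bullet(\mathcal{A},\mathbb{C})/\partial\widetilde{C}^\bullet(\mathcal{A},\mathbb{C})$, and $H^q(\mathcal{A},\mathbb{C})$ is its $q$-th cohomology. *)

(* Defs.v *)
From HB Require Import structures.
From mathcomp Require Import all_boot all_order all_algebra all_fingroup.
From mathcomp Require Import ring.
From mathcomp Require Import mpoly.

Set Implicit Arguments.
Unset Strict Implicit.
Unset Printing Implicit Defensive.

Import GRing.Theory Num.Theory.
Local Open Scope ring_scope.

(* A C[∂]-module is an lmodType over {poly K}: ∂ acts as 'X *: _ and the
   scalar c as c%:P *: _.  An element sum_k λ^k ⊗ s_k of K[λ] ⊗ A is given by
   the sequence s of its coefficients; trailing zeros are allowed, so two such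
   sequences denote the same element iff they agree under s`_k for all k. *)

Section LambdaBracket.
Variables (K : fieldType) (A : lmodType {poly K}) (br : A -> A -> seq A).

(* The coefficient at the monomial m of q * [a_p b], where λ is replaced by p;
   p and q are polynomials in two variables λ, μ whose coefficients lie in
   K[∂] and act on the coefficients of the bracket. *)
Definition brq (q p : {mpoly {poly K}[2]}) (a b : A) (m : 'X_{1..2}) : A :=
  \sum_(k < size (br a b)) (q * p ^+ k)@_m *: (br a b)`_k.

Local Notation "∂" := (('X : {poly K})%:MP_[2]).
Local Notation "'λ'" := ('X_(@Ordinal 2 0 isT) : {mpoly {poly K}[2]}).
Local Notation "'μ'" := ('X_(@Ordinal 2 1 isT) : {mpoly {poly K}[2]}).

Record lie_conformal_axioms : Prop := LieConformalAxioms {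
  lca_linearl : forall (c : K) a a' b k,
    (br (c%:P *: a + a') b)`_k = c%:P *: (br a b)`_k + (br a' b)`_k;
  lca_linearr : forall (c : K) a b b' k,
    (br a (c%:P *: b + b'))`_k = c%:P *: (br a b)`_k + (br a b')`_k;
  lca_sesquil : forall a b m, brq 1 λ ('X *: a) b m = brq (- λ) λ a b m;
  lca_sesquir : forall a b m, brq 1 λ a ('X *: b) m = brq (∂ + λ) λ a b m;
  lca_skew : forall a b m, brq 1 λ a b m = brq (- 1) (- λ - ∂) b a m;
  lca_jacobi : forall a b c m,
    \sum_(k < size (br b c)) brq (μ ^+ k) λ a (br b c)`_k m
    = \sum_(k < size (br a b)) brq (λ ^+ k) (λ + μ) (br a b)`_k c m
      + \sum_(k < size (br a c)) brq (λ ^+ k) μ b (br a c)`_k m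
}.

End LambdaBracket.

Record lieConformal (K : fieldType) := LieConformal {
  lca_sort :> lmodType {poly K};
  lca_br : lca_sort -> lca_sort -> seq lca_sort;
  lca_axioms : lie_conformal_axioms lca_br
}.

Section Cohomology.
Variables (K : fieldType) (A : lieConformal K).

Definition precochain (n : nat) := {ffun 'I_n -> A} -> {mpoly K[n]}.

Definition upd (n : nat) (a : {ffun 'I_n -> A}) (i : 'I_n) (x : A) :=
  [ffun k => if k == i then x else a k].

Record is_cochain (n : nat) (g : precochain n) : Prop := IsCochain {
  cochain_linear : forall a i (c : K) (x y : A),
    g (upd a i (c%:P *: x + y)) = c *: g (upd a i x) + g (upd a i y);
  cochain_sesqui : forall a i,
    g (upd a i ('X *: a i)) = - 'X_i * g a;
  cochain_skew : forall (a : {ffun 'I_n -> A}) (s : 'S_n),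
    g [ffun k => a (s k)] \mPo [tuple 'X_(s k) | k < n]
    = (-1) ^+ s *: g a
}.

(* For i < j, the family (x, a_0, .., ^a_i, .., ^a_j, .., a_n). *)
Definition contract (T : Type) (n : nat) (i j : 'I_n.+1) (x : T)
    (a : 'I_n.+1 -> T) (k : 'I_n) : T :=
  if val k is k'.+1 then a (inord (bump j (bump i k'))) else x.

(* Indices start at 0 here; the signs (-1)^(i+j) are the same as with indices
   starting at 1.  For n = 0 the sum is empty, so that d_0 = 0. *)
Definition dd (n : nat) (g : precochain n) : precochain n.+1 := fun a =>
  \sum_(i < n.+1) \sum_(j < n.+1 | (i < j)%N) (-1) ^+ (i + j) *:
    \sum_(k < size (lca_br (a i) (a j)))
      'X_i ^+ k
      * (g (finfun (contract i j (lca_br (a i) (a j))`_k a))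
           \mPo [tuple contract i j ('X_i + 'X_j) (fun l => 'X_l) l | l < n]).

Definition del (n : nat) (g : precochain n) : precochain n := fun a =>
  (\sum_(i < n) 'X_i) * g a.

(* The class of g in the reduced complex (cochains modulo ∂-multiples) is 0. *)
Definition reduced0 (n : nat) (g : precochain n) : Prop :=
  exists2 h, is_cochain h & g =1 del h.

Definition reduced_cocycle (n : nat) (g : precochain n) : Prop :=
  is_cochain g /\ reduced0 (dd g).

Definition reduced_coboundary (n : nat) : precochain n -> Prop :=
  match n with
  | 0 => fun g => reduced0 g
  | n'.+1 => fun g =>
      exists2 h, is_cochain h & reduced0 (fun a => g a - dd h a)
  end.

(* dim H^q = m: some m reduced cocycles form a basis of the space of reduced
   cocycles modulo reduced coboundaries. *)
Definition reduced_cohomology_dim (q m : nat) : Prop :=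
  exists e : 'I_m -> precochain q,
  [/\ forall i, reduced_cocycle (e i),
      forall c : 'I_m -> K,
        reduced_coboundary (fun a => \sum_i c i *: e i a) ->
        forall i, c i = 0
    & forall z, reduced_cocycle z ->
        exists c : 'I_m -> K,
          reduced_coboundary (fun a => z a - \sum_i c i *: e i a)].

End Cohomology.

Definition sv_struct_val (R : comNzRingType) (h D x : R) (i j l : nat) : R :=
  match i, j, l with
  | 0, 0, 0 => D + 2%:R * x
  | 0, 1, 1 | 0, 3, 3 => D + x
  | 0, 2, 2 => D + h * x
  | 1, 0, 1 | 3, 0, 3 => x
  | 2, 0, 2 => - (D + h * (- x - D))
  | 1, 2, 2 => 1
  | 2, 1, 2 => - 1
  | 1, 3, 3 => 2%:R
  | 3, 1, 3 => - 2%:R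
  | 2, 2, 3 => D + 2%:R * x
  | _, _, _ => 0
  end.

Lemma sv_struct_val_skew (R : comNzRingType) (h D x : R) (i j l : 'I_4) :
  h * 2%:R = 3%:R ->
  sv_struct_val h D (- x - D) j i l = - sv_struct_val h D x i j l.
Proof.
move=> h3; case: i => [[|[|[|[|]]]] //= ?]; case: j => [[|[|[|[|]]]] //= ?];
  case: l => [[|[|[|[|]]]] //= ?]; ring.
Qed.

Lemma sv_struct_val_jacobi (R : comNzRingType) (h D x y : R)
    (i j l t : 'I_4) : h * 2%:R = 3%:R ->
  \sum_(u < 4) sv_struct_val h (D + x) y j l u * sv_struct_val h D x i u t
  = \sum_(u < 4) sv_struct_val h (- (x + y)) x i j u
                 * sv_struct_val h D (x + y) u l t
    + \sum_(u < 4) sv_struct_val h (D + y) x i l u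
                   * sv_struct_val h D y j u t.
Proof.
move=> h3; have key c p q : p - q = (h * 2%:R - 3%:R) * c -> p = q.
  by rewrite h3 subrr mul0r => /subr0_eq.
rewrite !big_ord_recr !big_ord0 /=.
case: i => [[|[|[|[|]]]] //= ?]; case: j => [[|[|[|[|]]]] //= ?];
  case: l => [[|[|[|[|]]]] //= ?]; case: t => [[|[|[|[|]]]] //= ?];
  try ring.
- apply: (key (- (x * (D + x + 2%:R * y)))); ring.
- apply: (key (y * (D + 2%:R * x + y))); ring.
- apply: (key ((D + x + y) * (x - y))); ring.
Qed.

Section ExtendedSchrodingerVirasoro.
Variable K : numFieldType.

Local Notation "∂" := (('X : {poly K})%:P).
Local Notation "'λ'" := ('X : {poly {poly K}}).

Definition svL : 'I_4 := @Ordinal 4 0 isT.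
Definition svN : 'I_4 := @Ordinal 4 1 isT.
Definition svY : 'I_4 := @Ordinal 4 2 isT.
Definition svM : 'I_4 := @Ordinal 4 3 isT.

Local Notation "''e_' k" := (delta_mx 0 k : 'rV[{poly {poly K}}]_4)
  (at level 8, k at level 2).

Definition sv_half (i j : 'I_4) : 'rV[{poly {poly K}}]_4 :=
  if (i == svL) && (j == svL) then (∂ + 2%:R * λ) *: 'e_svL
  else if (i == svL) && (j == svY) then
    (∂ + (3%:R / 2%:R : K)%:P%:P * λ) *: 'e_svY
  else if (i == svL) && (j == svM) then (∂ + λ) *: 'e_svM
  else if (i == svL) && (j == svN) then (∂ + λ) *: 'e_svN
  else if (i == svY) && (j == svY) then (∂ + 2%:R * λ) *: 'e_svM
  else if (i == svN) && (j == svY) then 'e_svY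
  else if (i == svN) && (j == svM) then 2%:R *: 'e_svM
  else 0.

(* The brackets listed in sv_half all have i <= j in the order L, N, Y, M; the
   other ones are given by [g_i λ g_j] = - [g_j (-λ-∂) g_i]. *)
Definition sv_table (i j : 'I_4) : 'rV[{poly {poly K}}]_4 :=
  if (i <= j)%N then sv_half i j
  else - map_mx (fun p => p \Po (- λ - ∂)) (sv_half j i).

(* [f(∂)g_i λ h(∂)g_j] = f(-λ) h(∂+λ) [g_i λ g_j] *)
Definition sv_coord (a b : 'rV[{poly K}]_4) (l : 'I_4) : {poly {poly K}} :=
  \sum_i \sum_j ((a 0 i)^:P \Po (- λ)) * ((b 0 j)^:P \Po (∂ + λ))
                * sv_table i j 0 l.

Definition sv_br (a b : 'rV[{poly K}]_4) : seq 'rV[{poly K}]_4 :=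
  mkseq (fun k => \row_l (sv_coord a b l)`_k)
    (\max_l size (sv_coord a b l)).


Local Notation T := {mpoly {poly K}[2]}.
Local Notation iota := (@mpolyC 2 {poly K} \o polyC).

(* f(D) and p(D, x), for polynomials f in ∂ and p in ∂ and λ *)
Definition sv_sub (D : T) : {poly K} -> T := horner_eval D \o map_poly iota.
HB.instance Definition _ D := GRing.RMorphism.copy (sv_sub D)
  (horner_eval D \o map_poly iota).
Definition sv_ev (D x : T) : {poly {poly K}} -> T :=
  horner_eval x \o map_poly (sv_sub D).
HB.instance Definition _ D x := GRing.RMorphism.copy (sv_ev D x)
  (horner_eval x \o map_poly (sv_sub D)).

Lemma sv_subX D : sv_sub D 'X = D.
Proof. by rewrite /sv_sub /= map_polyX /horner_eval hornerX. Qed.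

Lemma sv_subC D c : sv_sub D c%:P = c%:P%:MP.
Proof. by rewrite /sv_sub /= map_polyC /= /horner_eval hornerC. Qed.

Lemma sv_evX D x : sv_ev D x 'X = x.
Proof. by rewrite /sv_ev /= map_polyX /horner_eval hornerX. Qed.

Lemma sv_evC D x f : sv_ev D x f%:P = sv_sub D f.
Proof. by rewrite /sv_ev /= map_polyC /= /horner_eval hornerC. Qed.

Lemma sv_sub_id f : sv_sub ('X)%:MP f = f%:MP.
Proof.
elim/poly_ind: f => [|f c IHf]; first by rewrite !rmorph0.
by rewrite rmorphD rmorphM /= sv_subX sv_subC IHf -mpolyCM -mpolyCD.
Qed.

Lemma sv_ev_lift D x f p : sv_ev D x (f^:P \Po p) = sv_sub (sv_ev D x p) f.
Proof.
elim/poly_ind: f => [|f c IHf]; first by rewrite !rmorph0.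
rewrite !rmorphD !rmorphM /= sv_subX sv_subC map_polyX map_polyC /= comp_polyX.
by rewrite comp_polyC IHf sv_evC sv_subC.
Qed.

Lemma sv_ev_sum D x N (p : {poly {poly K}}) : (size p <= N)%N ->
  \sum_(k < N) sv_sub D p`_k * x ^+ k = sv_ev D x p.
Proof.
move=> le_pN; rewrite /sv_ev /= /horner_eval (@horner_coef_wide _ N) //.
  by apply: eq_bigr => k _; rewrite coef_map.
by apply: leq_trans le_pN; apply: size_poly.
Qed.

Lemma sv_size_coord a b l : (size (sv_coord a b l) <= size (sv_br a b))%N.
Proof. by rewrite size_mkseq (leq_bigmax l). Qed.

Lemma sv_brE a b k l : (sv_br a b)`_k 0 l = (sv_coord a b l)`_k.
Proof.
case: (ltnP k (size (sv_br a b))) => hk.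
  by move: hk; rewrite size_mkseq => hk; rewrite nth_mkseq // mxE.
rewrite nth_default // mxE nth_default //.
by apply: leq_trans hk; apply: sv_size_coord.
Qed.

Lemma sv_brqE q p a b m l :
  brq sv_br q p a b m 0 l = (q * sv_ev ('X)%:MP p (sv_coord a b l))@_m.
Proof.
rewrite /brq summxE -(sv_ev_sum _ _ (sv_size_coord a b l)) mulr_sumr raddf_sum /=.
apply: eq_bigr => k _; rewrite mxE sv_brE sv_sub_id.
by rewrite mulrCA mcoeffCM mulrC.
Qed.

Definition sv_struct (D x : T) i j l := sv_ev D x (sv_table i j 0 l).

Lemma sv_ev_coord D x a b l : sv_ev D x (sv_coord a b l) =
  \sum_i \sum_j sv_sub (- x) (a 0 i) * sv_sub (D + x) (b 0 j) * sv_struct D x i j l.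
Proof.
rewrite rmorph_sum; apply: eq_bigr => i _; rewrite rmorph_sum.
apply: eq_bigr => j _; rewrite !rmorphM /= !sv_ev_lift.
by rewrite rmorphN rmorphD /= sv_evX sv_evC sv_subX.
Qed.

Lemma sv_nested_r D x y a b c t :
  \sum_(k < size (sv_br b c)) x ^+ k * sv_ev D y (sv_coord a (sv_br b c)`_k t)
  = \sum_i \sum_u sv_sub (- y) (a 0 i) * sv_ev (D + y) x (sv_coord b c u)
                  * sv_struct D y i u t.
Proof.
under eq_bigr do rewrite sv_ev_coord mulr_sumr.
rewrite exchange_big; apply: eq_bigr => i _ /=.
under eq_bigr do rewrite mulr_sumr.
rewrite exchange_big; apply: eq_bigr => u _ /=.
rewrite -(sv_ev_sum _ _ (sv_size_coord b c u)) mulr_sumr mulr_suml.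
apply: eq_bigr => k _; rewrite sv_brE; ring.
Qed.

Lemma sv_nested_l D x y a b c t :
  \sum_(k < size (sv_br a b)) x ^+ k * sv_ev D y (sv_coord (sv_br a b)`_k c t)
  = \sum_u \sum_l sv_ev (- y) x (sv_coord a b u) * sv_sub (D + y) (c 0 l)
                  * sv_struct D y u l t.
Proof.
under eq_bigr do rewrite sv_ev_coord mulr_sumr.
rewrite exchange_big; apply: eq_bigr => u _ /=.
under eq_bigr do rewrite mulr_sumr.
rewrite exchange_big; apply: eq_bigr => l _ /=.
rewrite -(sv_ev_sum _ _ (sv_size_coord a b u)) !mulr_suml.
apply: eq_bigr => k _; rewrite sv_brE; ring.
Qed.

Lemma sv_structE D x i j l :
  sv_struct D x i j l
  = sv_struct_val (iota (3%:R / 2%:R)) D x i j l.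
Proof.
case: i => [[|[|[|[|]]]] //= ?]; case: j => [[|[|[|[|]]]] //= ?];
  case: l => [[|[|[|[|]]]] //= ?]; rewrite /sv_struct /sv_table /sv_half /=;
  rewrite !mxE /= ?mulr0 ?mulr1 ?comp_poly0 ?oppr0 ?rmorph0 ?rmorph1 //.
all: rewrite ?comp_polyD ?comp_polyM ?comp_polyX ?comp_polyC ?rmorph_nat.
all: rewrite ?(rmorphD, rmorphN, rmorphM, rmorph1, rmorph_nat) /=.
all: rewrite ?(rmorphD, rmorphN, rmorphM, rmorph1, rmorph_nat) /=.
all: rewrite ?(sv_evX, sv_evC, sv_subX, sv_subC) //.
all: ring.
Qed.

Lemma sv_three_halves : iota (3%:R / 2%:R) * 2%:R = 3%:R.
Proof.
by rewrite -(rmorph_nat iota 2) -rmorphM divfK ?pnatr_eq0 // rmorph_nat.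
Qed.

Lemma sv_jacobi D x y a b c t :
  \sum_(k < size (sv_br b c)) y ^+ k * sv_ev D x (sv_coord a (sv_br b c)`_k t)
  = \sum_(k < size (sv_br a b))
      x ^+ k * sv_ev D (x + y) (sv_coord (sv_br a b)`_k c t)
    + \sum_(k < size (sv_br a c))
        x ^+ k * sv_ev D y (sv_coord b (sv_br a c)`_k t).
Proof.
have E1 := sv_nested_r D y x a b c t.
have E2 := sv_nested_l D x (x + y) a b c t.
have E3 := sv_nested_r D x y b a c t.
apply: etrans E1 (etrans _ (esym (congr2 +%R E2 E3))).
pose F i j l := sv_sub (- x) (a 0 i) * sv_sub (- y) (b 0 j)
                * sv_sub (D + (x + y)) (c 0 l).
transitivity (\sum_i \sum_j \sum_l
    F i j l * \sum_u sv_struct (D + x) y j l u * sv_struct D x i u t).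
  apply: eq_bigr => i _; under eq_bigr do rewrite sv_ev_coord mulr_sumr mulr_suml.
  rewrite exchange_big; apply: eq_bigr => j _ /=.
  under eq_bigr do rewrite mulr_sumr mulr_suml.
  rewrite exchange_big; apply: eq_bigr => l _ /=.
  rewrite mulr_sumr; apply: eq_bigr => u _; rewrite /F addrA; ring.
transitivity (\sum_i \sum_j \sum_l
    F i j l * \sum_u sv_struct (- (x + y)) x i j u * sv_struct D (x + y) u l t
  + \sum_i \sum_j \sum_l
    F i j l * \sum_u sv_struct (D + y) x i l u * sv_struct D y j u t).
  rewrite -big_split; apply: eq_bigr => i _; rewrite -big_split.
  apply: eq_bigr => j _; rewrite -big_split; apply: eq_bigr => l _ /=.
  rewrite -mulrDr; congr (_ * _).
  under eq_bigr do rewrite !sv_structE.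
  under [X in _ = X + _]eq_bigr do rewrite !sv_structE.
  under [X in _ = _ + X]eq_bigr do rewrite !sv_structE.
  exact: sv_struct_val_jacobi sv_three_halves.
congr (_ + _).
  under [RHS]eq_bigr do under eq_bigr do
    rewrite sv_ev_coord mulr_suml mulr_suml.
  under [RHS]eq_bigr do rewrite exchange_big.
  rewrite [RHS]exchange_big; apply: eq_bigr => i _ /=.
  under [RHS]eq_bigr do under eq_bigr do rewrite mulr_suml mulr_suml.
  under [RHS]eq_bigr do rewrite exchange_big.
  rewrite [RHS]exchange_big; apply: eq_bigr => j _ /=.
  rewrite [RHS]exchange_big; apply: eq_bigr => l _ /=.
  rewrite mulr_sumr; apply: eq_bigr => u _; rewrite /F.
  have -> : - (x + y) + x = - y by ring.
  ring.
rewrite exchange_big; apply: eq_bigr => j _ /=.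
under [RHS]eq_bigr do rewrite sv_ev_coord mulr_sumr mulr_suml.
rewrite [RHS]exchange_big; apply: eq_bigr => i _ /=.
under [RHS]eq_bigr do rewrite mulr_sumr mulr_suml.
rewrite [RHS]exchange_big; apply: eq_bigr => l _ /=.
rewrite mulr_sumr; apply: eq_bigr => u _; rewrite /F.
have -> : D + (x + y) = D + y + x by ring.
ring.
Qed.

Lemma sv_combE (f : {poly K}) (a b : 'rV[{poly K}]_4) l :
  (f *: a + b) 0 l = f * a 0 l + b 0 l.
Proof. by rewrite !mxE. Qed.

Lemma sv_addE (a b : 'rV[{poly K}]_4) l : (a + b) 0 l = a 0 l + b 0 l.
Proof. by rewrite mxE. Qed.

Lemma sv_brq_sum N (q : nat -> T) p (c d : nat -> 'rV[{poly K}]_4) m t :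
  (\sum_(k < N) brq sv_br (q k) p (c k) (d k) m) 0 t
  = (\sum_(k < N) q k * sv_ev ('X)%:MP p (sv_coord (c k) (d k) t))@_m.
Proof.
by rewrite summxE raddf_sum; apply: eq_bigr => k _; apply: sv_brqE.
Qed.

Lemma sv_coordDl (c : K) a a' b l :
  sv_coord (c%:P *: a + a') b l = c%:P%:P * sv_coord a b l + sv_coord a' b l.
Proof.
rewrite /sv_coord mulr_sumr -big_split; apply: eq_bigr => i _ /=.

rewrite mulr_sumr -big_split; apply: eq_bigr => j _ /=.
rewrite sv_combE rmorphD rmorphM /= map_polyC /= comp_polyD comp_polyM.
rewrite comp_polyC; ring.
Qed.

Lemma sv_coordDr (c : K) a b b' l :
  sv_coord a (c%:P *: b + b') l = c%:P%:P * sv_coord a b l + sv_coord a b' l.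
Proof.
rewrite /sv_coord mulr_sumr -big_split; apply: eq_bigr => i _ /=.
rewrite mulr_sumr -big_split; apply: eq_bigr => j _ /=.
rewrite sv_combE rmorphD rmorphM /= map_polyC /= comp_polyD comp_polyM.
rewrite comp_polyC; ring.
Qed.

Lemma sv_axioms : lie_conformal_axioms (@sv_br).
Proof.
split.
- move=> c a a' b k; apply/rowP => l; apply: etrans (sv_brE _ _ _ _) _.
  apply: etrans _ (esym (sv_combE _ _ _ _)).
  rewrite sv_coordDl coefD coefCM.
  by congr (_ * _ + _); apply/esym/sv_brE.
- move=> c a b b' k; apply/rowP => l; apply: etrans (sv_brE _ _ _ _) _.
  apply: etrans _ (esym (sv_combE _ _ _ _)).
  rewrite sv_coordDr coefD coefCM.
  by congr (_ * _ + _); apply/esym/sv_brE.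
- move=> a b m; apply/rowP => l.
  apply: etrans (sv_brqE _ _ _ _ _ _) (etrans _ (esym (sv_brqE _ _ _ _ _ _))).
  apply: (congr1 (mcoeff m)).
  rewrite mul1r !sv_ev_coord mulr_sumr; apply: eq_bigr => i _.
  rewrite mulr_sumr; apply: eq_bigr => j _.
  by rewrite mxE rmorphM /= sv_subX !mulrA.
- move=> a b m; apply/rowP => l.
  apply: etrans (sv_brqE _ _ _ _ _ _) (etrans _ (esym (sv_brqE _ _ _ _ _ _))).
  apply: (congr1 (mcoeff m)).
  rewrite mul1r !sv_ev_coord mulr_sumr; apply: eq_bigr => i _.
  rewrite mulr_sumr; apply: eq_bigr => j _.
  by rewrite mxE rmorphM /= sv_subX; ring.
- move=> a b m; apply/rowP => l.
  apply: etrans (sv_brqE _ _ _ _ _ _) (etrans _ (esym (sv_brqE _ _ _ _ _ _))).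
  apply: (congr1 (mcoeff m)).
  move: ('X_ _) (_%:MP) => x D.
  rewrite mul1r mulN1r !sv_ev_coord exchange_big -sumrN.
  apply: eq_bigr => j _; rewrite -sumrN; apply: eq_bigr => i _ /=.
  rewrite !sv_structE (sv_struct_val_skew _ _ _ _ _ sv_three_halves).
  have -> : - (- x - D) = D + x by ring.
  have -> : D + (- x - D) = - x by ring.
  ring.
- move=> a b c m; apply/rowP => t.
  pose cst (x : 'rV[{poly K}]_4) (k : nat) := x.
  have E1 := sv_brq_sum (size (sv_br b c)) (GRing.exp 'X_(@Ordinal 2 1 isT))
    'X_(@Ordinal 2 0 isT) (cst a) (nth 0 (sv_br b c)) m t.
  have E2 := sv_brq_sum (size (sv_br a b)) (GRing.exp 'X_(@Ordinal 2 0 isT))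
    ('X_(@Ordinal 2 0 isT) + 'X_(@Ordinal 2 1 isT))
    (nth 0 (sv_br a b)) (cst c) m t.
  have E3 := sv_brq_sum (size (sv_br a c)) (GRing.exp 'X_(@Ordinal 2 0 isT))
    'X_(@Ordinal 2 1 isT) (cst b) (nth 0 (sv_br a c)) m t.
  apply: etrans E1 (etrans _ (esym (etrans (sv_addE _ _ _) (congr2 +%R E2 E3)))).
  apply: etrans _ (mcoeffD _ _ _); apply: (congr1 (mcoeff m)).
  exact: sv_jacobi.
Qed.

Definition extended_SV : lieConformal K := LieConformal sv_axioms.

End ExtendedSchrodingerVirasoro.

(* Main.v *)
From HB Require Import structures.
Require Import Defs.
From mathcomp Require Import all_boot all_order all_algebra all_fingroup.
From mathcomp Require Import complex reals.
From mathcomp Require Import ring zify.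
From mathcomp Require Import mpoly.

Set Implicit Arguments.
Unset Strict Implicit.
Unset Printing Implicit Defensive.

Import GRing.Theory Num.Theory.
Local Open Scope ring_scope.

(** A cochain is determined by the Taylor coefficients of its values on the
    generators, that is, by an alternating function on words whose letters are
    a generator and an exponent. After rescaling by factorials the letters
    multiply like the basis of a Lie algebra, the annihilation algebra: for
    instance the bracket of [gL i] and [gL j] is (i - j) times [gL (i + j - 1)],
    and that of [gL i] and [gN j] is - j times [gN (i + j - 1)]. The differential
    becomes that of Chevalley and Eilenberg ([coef_dd]), multiplication by the
    sum of the variables becomes an operator ∂ that is minus the action of [gL 0]
    ([coef_del]), and the functions obtained are exactly the alternating ones
    with bounded exponents ([realize_cochain]).

    Two letters act diagonally. By Cartan's formula contraction with [gN 0] is a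
    homotopy from 0 to the charge (Y has charge 1, M has charge 2), and this
    leaves the words in L and N only. Contraction with [gL 1] is a homotopy from
    0 to half the weight. In weight zero the complex is finite: [gL 0] is the
    only remaining letter of negative weight, which leaves twelve words
    ([weight_zero_perm]). Inspection of these shows that the unreduced
    cohomology has dimension 1, 3, 2 in the degrees 0, 3, 4 and vanishes in the
    other ones ([finite_cohomology]).

    Finally ∂ is injective in positive degrees, and Cartan's formula for [gL 0]
    shows that it acts by zero on cohomology: if r is a cocycle, then the
    contraction of r with [gL 0] has differential ∂ r. Hence the reduced
    cohomology in degree q is the sum of the unreduced ones in degrees q and
    q + 1, which gives 1, 0, 3, 5, 2. This long exact sequence argument is made
    explicit in [classes_spanning] and [classes_independent]; as the contraction
    with [gL 1] commutes with ∂ only up to the contraction with [gL 0], the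
    reduced cocycles split into those of weight 0 and those of weight 2, the
    latter being the contractions. *)

(** * Alternating functions on words *)

Section Alternating.
Variables (K : numDomainType) (X : eqType).
Implicit Types (F G : seq X -> K) (s t : seq X) (x y : X).

Definition ins x F : seq X -> K := fun s => F (x :: s).

Definition alternating F := forall s1 a b s2,
  F (s1 ++ a :: b :: s2) = - F (s1 ++ b :: a :: s2).

Lemma alternating_ins x F : alternating F -> alternating (ins x F).
Proof. by move=> aF s1 a b s2; apply: (aF (x :: s1)). Qed.

Lemma alternating_lin (k : K) F G :
  alternating F -> alternating G -> alternating (fun s => k * F s + G s).
Proof. by move=> aF aG s1 a b s2; rewrite aF aG; ring. Qed.

Lemma alternatingD F G :
  alternating F -> alternating G -> alternating (fun s => F s + G s).
Proof. by move=> aF aG s1 a b s2; rewrite aF aG opprD. Qed.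

Lemma alternating_sum (I : Type) (r : seq I) (f : I -> seq X -> K) :
  (forall i, alternating (f i)) -> alternating (fun s => \sum_(i <- r) f i s).
Proof.
by move=> af s1 a b s2; rewrite -sumrN; apply: eq_bigr => i _; apply: af.
Qed.

Lemma alternating_scale (phi : seq X -> K) F :
    (forall s t, perm_eq s t -> phi s = phi t) ->
  alternating F -> alternating (fun s => phi s * F s).
Proof.
move=> phiP aF s1 a b s2; rewrite aF mulrN; congr (- (_ * _)); apply: phiP.
by rewrite perm_cat2l -(cat1s a) -(cat1s b) perm_catCA.
Qed.

Lemma alternating_move F : alternating F -> forall t1 x t2,
  F (t1 ++ x :: t2) = (-1) ^+ size t1 * F (x :: t1 ++ t2).
Proof.
move=> aF t1; elim: t1 F aF => [|y t1 IH] F aF x t2; first by rewrite mul1r.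
have := IH _ (alternating_ins y aF) x t2; rewrite /ins /= => ->.
have /= -> := aF [::] y x (t1 ++ t2); rewrite exprS; ring.
Qed.

Lemma alternating_perm F s t : alternating F -> perm_eq s t ->
  exists b : bool, F s = (-1) ^+ b * F t.
Proof.
elim: s t F => [|x s IH] t F aF.
  by rewrite perm_sym => /perm_nilP ->; exists false; rewrite mul1r.
move=> st; have xt : x \in t by rewrite -(perm_mem st) mem_head.
case/splitPr: xt st => t1 t2 st.
have /(IH _ _ (alternating_ins x aF)) [b] : perm_eq s (t1 ++ t2).
  by rewrite -(perm_cons x) (perm_trans st) // -[x :: t2]cat1s perm_catCA.
rewrite /ins => ->; rewrite (alternating_move aF).
exists (b (+) odd (size t1)); rewrite signr_addb signr_odd -!mulrA.
by rewrite [_ ^+ size t1 * (_ * _)]mulrA -expr2 sqrr_sign mul1r.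
Qed.

Lemma alternating_uniq F s : alternating F -> F s != 0 -> uniq s.
Proof.
elim: s F => //= x s IH F aF Fn0; rewrite (IH _ (alternating_ins x aF) Fn0) andbT.
apply: contra_neqN Fn0; case/splitPr => s1 s2.
have := alternating_move (alternating_ins x aF) s1 x s2; rewrite /ins => ->.
have /eqP := aF [::] x x (s1 ++ s2); rewrite -addr_eq0 -mulr2n mulrn_eq0 /=.
by move=> /eqP ->; rewrite mulr0.
Qed.

(** Exterior multiplication by the element dual to [x]: the Laplace expansion
    of a determinant. *)
Fixpoint ext x F s : K :=
  if s is a :: s' then (a == x)%:R * F s' - ext x (ins a F) s' else 0.

Lemma eq_ext x F G : F =1 G -> ext x F =1 ext x G.
Proof.
move=> FG s; elim: s F G FG => //= a s IH F G FG.
by rewrite FG; congr (_ - _); apply: IH => t; apply: FG.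
Qed.

Lemma extN x F s : ext x (fun t => - F t) s = - ext x F s.
Proof.
elim: s F => [|a s IH] F /=; first by rewrite oppr0.
by have := IH (ins a F); rewrite /ins => ->; ring.
Qed.

Lemma alternating_ext x F : alternating F -> alternating (ext x F).
Proof.
move=> aF s1; elim: s1 F aF => [|y s1 IH] F aF a b s2 /=.
  rewrite (eq_ext _ (G := fun t => - ins a (ins b F) t)); last first.
    by move=> t; apply: (aF [::]).
  by rewrite extN /ins; ring.
by rewrite aF (IH _ (alternating_ins y aF)) /ins; ring.
Qed.

Lemma ext_neq0 x F s : ext x F s != 0 ->
  exists2 t, F t != 0 & perm_eq s (x :: t).
Proof.
elim: s F => [|a s IH] F /=; first by rewrite eqxx.
have [->|_] := eqVneq a x; last first.
  rewrite mul0r sub0r oppr_eq0 => /IH [t Ft st]; exists (a :: t) => //.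
  by rewrite -(perm_cons a) in st; rewrite (perm_trans st) // (perm_catCA [:: a] [:: x]).
rewrite mul1r; have [F0|F0 _] := eqVneq (F s) 0; last by exists s.
rewrite F0 sub0r oppr_eq0 => /IH [t Ft st]; exists (x :: t) => //.
by rewrite perm_cons.
Qed.

Definition wedge (S : seq X) : seq X -> K :=
  foldr ext (fun s => (s == [::])%:R) S.

Lemma alternating_wedge S : alternating (wedge S).
Proof.
elim: S => [|x S IH] /=; last exact: alternating_ext.
by case=> [|? ?] a b s2; rewrite oppr0.
Qed.

Lemma wedge_neq0 S s : wedge S s != 0 -> perm_eq s S.
Proof.
elim: S s => [|x S IH] s /=; first by case: s => [|? ?]; rewrite ?eqxx.
by case/ext_neq0 => t /IH tS /perm_trans; apply; rewrite perm_cons.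
Qed.

Lemma ext_notin x F s : x \notin s -> ext x F s = 0.
Proof.
elim: s F => //= a s IH F; rewrite inE negb_or eq_sym => /andP[/negPf -> xs].
by rewrite mul0r IH // subrr.
Qed.

Lemma wedge_diag S : uniq S -> wedge S S = 1.
Proof.
elim: S => //= x S IH /andP[xS uS].
by rewrite eqxx mul1r IH // ext_notin // subr0.
Qed.

End Alternating.

Section PermutationSign.
Variables (K : numDomainType) (X : eqType) (F : seq X -> K).
Hypothesis aF : alternating F.

Lemma alternating_swap s1 a s2 b s3 :
  F (s1 ++ a :: s2 ++ b :: s3) = - F (s1 ++ b :: s2 ++ a :: s3).
Proof.
have mv x t1 t2 : F (s1 ++ x :: t1 ++ t2) = (-1) ^+ size t1 * F (s1 ++ t1 ++ x :: t2).
  elim: t1 s1 => [|y t1 IH] s0 /=; first by rewrite mul1r.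
  by rewrite aF exprS; have := IH (rcons s0 y); rewrite !cat_rcons => ->; ring.
by rewrite (mv a s2) (mv b s2); have := aF (s1 ++ s2) a b s3; rewrite -!catA => ->; ring.
Qed.

(** Every permutation is a product of transpositions, and a transposition of two
    distant entries is an odd number of adjacent swaps. *)
Lemma alternating_permS n (v : 'I_n -> X) (s : 'S_n) :
  F [seq v (s k) | k <- enum 'I_n] = (-1) ^+ s * F [seq v k | k <- enum 'I_n].
Proof.
have tpermF (w : 'I_n -> X) i j : i != j ->
    F [seq w (tperm i j k) | k <- enum 'I_n] = - F [seq w k | k <- enum 'I_n].
  have half p1 i0 p2 j0 p3 : enum 'I_n = p1 ++ i0 :: p2 ++ j0 :: p3 ->
      F [seq w (tperm i0 j0 k) | k <- enum 'I_n] = - F [seq w k | k <- enum 'I_n].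
    move=> E; have U := enum_uniq 'I_n; rewrite E in U *.
    have i1 : i0 \notin p1 ++ p2 ++ j0 :: p3.
      by move: U; rewrite -[i0 :: _]cat1s uniq_catCA /= => /andP[].
    have j1 : j0 \notin (p1 ++ i0 :: p2) ++ p3.
      have E2 : p1 ++ i0 :: p2 ++ j0 :: p3 = (p1 ++ i0 :: p2) ++ [:: j0] ++ p3.
        by rewrite -catA.
      by move: U; rewrite E2 uniq_catCA /= => /andP[].
    rewrite !(map_cat, map_cons) alternating_swap tpermL tpermR.
    have fix_ p : {subset p <= p1 ++ p2 ++ p3} ->
        [seq w (tperm i0 j0 k) | k <- p] = [seq w k | k <- p].
      move=> sp; apply/eq_in_map => k /sp kp; rewrite tpermD //.
        apply: contraNneq i1 => ->; move: kp; rewrite !mem_cat inE.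
        by case/or3P => ->; rewrite ?orbT.
      apply: contraNneq j1 => ->; move: kp; rewrite !mem_cat inE.
      by case/or3P => ->; rewrite ?orbT.
    by rewrite !fix_ // => k kp; rewrite !mem_cat kp ?orbT.
  move=> ij; have split_enum k : exists p1 p2, enum 'I_n = p1 ++ k :: p2.
    by have : k \in enum 'I_n by [rewrite mem_enum]; case/splitPr => p1 p2; exists p1, p2.
  have [p1 [p2 E]] := split_enum i.
  have : j \in p1 ++ i :: p2 by rewrite -E mem_enum.
  rewrite mem_cat inE [j == i]eq_sym (negPf ij) /= => /orP[] /splitPr jp.
    case: jp E => q1 q2 E; rewrite tpermC; apply: (half q1 j q2 i p2).
    by rewrite E -catA.
  by case: jp E => q1 q2 E; apply: (half p1 i q1 j q2).
have [ts -> dts] := prod_tpermP s; elim: ts dts v => [|t ts IH] /= dts v.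
  rewrite big_nil odd_perm1 mul1r; congr F; apply: eq_map => k; by rewrite perm1.
case/andP: dts => dt dts.
rewrite big_cons odd_mul_tperm (dt : t.1 != t.2).
rewrite (eq_map (g := fun k => v ((\prod_(t <- ts) tperm t.1 t.2)%g (tperm t.1 t.2 k)))).
  rewrite (tpermF (fun k => v ((\prod_(t <- ts) tperm t.1 t.2)%g k))) // IH //.
  by rewrite signr_addb expr1 mulN1r mulNr.
by move=> k; rewrite permM.
Qed.
End PermutationSign.

(** Lets [ring] prove an equality modulo two known equations, which the user
    combines linearly by hand. *)
Lemma eq_lin2 (R : zmodType) (a b p q u v : R) :
  p = q -> u = v -> a - b = (p - q) + (u - v) -> a = b.
Proof. by move=> -> ->; rewrite !subrr addr0 => /subr0_eq. Qed.

(** * The Chevalley-Eilenberg complex of a Lie algebra with a monomial basis *)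

Section ChevalleyEilenberg.
Variables (K : numDomainType) (X : eqType) (c : X -> X -> K) (m : X -> X -> X).
Implicit Types (F G : seq X -> K) (s t : seq X) (x y : X).

(** The bracket of the basis elements [x] and [y] is [c x y] times [m x y];
    [theta x] is the transpose of the action of [x] on tensors. *)
Fixpoint theta x F s : K :=
  if s is y :: s' then c x y * F (m x y :: s') + theta x (ins y F) s' else 0.

(** The differential, defined so that Cartan's formula
    [ins x \o d + d \o ins x = - theta x] holds by definition. *)
Fixpoint differential F s : K :=
  if s is x :: s' then - theta x F s' - differential (ins x F) s' else 0.

Local Notation d := differential.

Lemma eq_theta x F G : F =1 G -> theta x F =1 theta x G.
Proof.
move=> FG s; elim: s F G FG => //= a s IH F G FG.
by rewrite FG; congr (_ + _); apply: IH => t; apply: FG.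
Qed.

Lemma eq_d F G : F =1 G -> d F =1 d G.
Proof.
move=> FG s; elim: s F G FG => //= a s IH F G FG.
by rewrite (eq_theta a FG); congr (_ - _); apply: IH => t; apply: FG.
Qed.

Lemma theta_lin x (k : K) F G s :
  theta x (fun t => k * F t + G t) s = k * theta x F s + theta x G s.
Proof.
elim: s F G => [|y s IH] F G /=; first by rewrite mulr0 addr0.
by rewrite (eq_theta _ (G := fun t => k * ins y F t + ins y G t)) // IH; ring.
Qed.

Lemma d_lin (k : K) F G s :
  d (fun t => k * F t + G t) s = k * d F s + d G s.
Proof.
elim: s F G => [|y s IH] F G /=; first by rewrite mulr0 addr0.
by rewrite theta_lin (eq_d (G := fun t => k * ins y F t + ins y G t)) // IH; ring.
Qed.

Lemma theta0 x s : theta x (fun=> 0) s = 0.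
Proof. by elim: s => //= y s ->; rewrite mulr0 addr0. Qed.

Lemma d0 s : d (fun=> 0) s = 0.
Proof. by elim: s => //= y s ->; rewrite theta0 oppr0 addr0. Qed.

Lemma thetaZ x (k : K) F s : theta x (fun t => k * F t) s = k * theta x F s.
Proof.
rewrite (eq_theta _ (G := fun t => k * F t + 0)) => [|t]; last by rewrite addr0.
by rewrite theta_lin theta0 addr0.
Qed.

Lemma dZ (k : K) F s : d (fun t => k * F t) s = k * d F s.
Proof.
rewrite (eq_d (G := fun t => k * F t + 0)) => [|t]; last by rewrite addr0.
by rewrite d_lin d0 addr0.
Qed.

Lemma thetaD x F G s :
  theta x (fun t => F t + G t) s = theta x F s + theta x G s.
Proof.
rewrite (eq_theta _ (G := fun t => 1 * F t + G t)) => [|t]; last by rewrite mul1r.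
by rewrite theta_lin mul1r.
Qed.

Lemma dD F G s : d (fun t => F t + G t) s = d F s + d G s.
Proof.
rewrite (eq_d (G := fun t => 1 * F t + G t)) => [|t]; last by rewrite mul1r.
by rewrite d_lin mul1r.
Qed.

Lemma thetaN x F s : theta x (fun t => - F t) s = - theta x F s.
Proof.
rewrite (eq_theta _ (G := fun t => -1 * F t)) => [|t]; last by rewrite mulN1r.
by rewrite thetaZ mulN1r.
Qed.

Lemma dN F s : d (fun t => - F t) s = - d F s.
Proof.
rewrite (eq_d (G := fun t => -1 * F t)) => [|t]; last by rewrite mulN1r.
by rewrite dZ mulN1r.
Qed.

Lemma d_sum (I : Type) (r : seq I) (f : I -> seq X -> K) s :
  d (fun t => \sum_(i <- r) f i t) s = \sum_(i <- r) d (f i) s.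
Proof.
elim: r => [|i r IH].
  by rewrite big_nil (eq_d (G := fun=> 0)) ?d0 // => t; rewrite big_nil.
rewrite big_cons -IH -dD; apply: eq_d => t; by rewrite big_cons.
Qed.

Lemma theta_sum (I : Type) (r : seq I) (f : I -> seq X -> K) x s :
  theta x (fun t => \sum_(i <- r) f i t) s = \sum_(i <- r) theta x (f i) s.
Proof.
elim: r => [|i r IH].
  by rewrite big_nil (eq_theta _ (G := fun=> 0)) ?theta0 // => t; rewrite big_nil.
rewrite big_cons -IH -thetaD; apply: eq_theta => t; by rewrite big_cons.
Qed.

Lemma ins_d x F s : ins x (d F) s = - theta x F s - d (ins x F) s.
Proof. by []. Qed.

Lemma ins_theta x y F s :
  ins y (theta x F) s = c x y * ins (m x y) F s + theta x (ins y F) s.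
Proof. by []. Qed.

Lemma theta_alternating x F : alternating F -> alternating (theta x F).
Proof.
move=> aF s1; elim: s1 F aF => [|y s1 IH] F aF a b s2 /=.
  rewrite (eq_theta _ (G := fun t => - ins a (ins b F) t)); last first.
    by move=> t; apply: (aF [::]).
  by rewrite thetaN /ins (aF [::] (m x a)) /= (aF [::] a (m x b)) /=; ring.
by rewrite (aF (m x y :: s1)) (IH _ (alternating_ins y aF)) /ins /=; ring.
Qed.

(** Bringing the j-th entry to the front costs the sign (-1)^j. Together with
    the next lemma this compares the recursive differential with the usual
    double sum. *)
Lemma theta_sumE x0 x F s : alternating F ->
  theta x F s = \sum_(j < size s) (-1) ^+ j *
    (c x (nth x0 s j) * F (m x (nth x0 s j) :: take j s ++ drop j.+1 s)).
Proof.
elim: s F => [|y s IH] F aF /=; first by rewrite big_ord0.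
rewrite big_ord_recl /= mul1r drop0 IH; last exact: alternating_ins.
congr (_ + _); apply: eq_bigr => j _; rewrite exprS /ins (aF [::]) /=; ring.
Qed.

Lemma d_sumE x0 F s : alternating F ->
  d F s = \sum_(i < size s) \sum_(j < size s | (i < j)%N) (-1) ^+ (i + j) *
    (c (nth x0 s i) (nth x0 s j) * F (m (nth x0 s i) (nth x0 s j) ::
       [seq nth x0 s (bump j (bump i k)) | k <- iota 0 (size s).-2])).
Proof.
elim: s F => [|x s IH] F aF /=; first by rewrite big_ord0.
rewrite big_ord_recl /=; congr (_ + _).
  rewrite big_mkcond big_ord_recl /= add0r (theta_sumE x0) // -sumrN.
  apply: eq_bigr => j _ /=; rewrite add0n exprS mulN1r mulNr; congr (- (_ * (_ * F (_ :: _)))).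
  have szj : size (take j s) = j by rewrite size_takel // ltnW.
  apply: (@eq_from_nth _ x0); rewrite size_cat szj size_drop ?size_map ?size_iota.
    by case: (j) => /=; lia.
  move=> k lek; rewrite (nth_map 0%N) ?size_iota; last by case: (j) lek => /=; lia.
  rewrite nth_iota ?add0n; last by case: (j) lek => /=; lia.
  rewrite nth_cat szj /bump /=; case: ltnP => jk.
    by rewrite nth_take //; case: ltnP; rewrite ?add0n //=; lia.
  rewrite nth_drop; case: ltnP; rewrite ?add1n //=; first by move=> _; congr (nth _ _ _); lia.
  by lia.
rewrite IH; last exact: alternating_ins.
rewrite -sumrN; apply: eq_bigr => i _.
rewrite [RHS]big_mkcond [RHS]big_ord_recl /= add0r big_mkcond -sumrN.
apply: eq_bigr => j _ /=.
rewrite ltnS; case: ltnP => ij; last by rewrite oppr0.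
rewrite addnS addSn !exprS mulrA mulrNN !mul1r /ins (aF [::]) /= !mulrN opprK.
congr (_ * (_ * F (_ :: _))).
have -> : (size s).-1 = (size s).-2.+1.
  by move: ij (ltn_ord i) (ltn_ord j); lia.
have bumpSS h k : bump (bump 0 h) k.+1 = (bump h k).+1 by rewrite /bump; lia.
have bumpS0 h : bump (bump 0 h) 0 = 0%N by [].
rewrite -[iota 0 _.+1]/(0%N :: iota 1 _) map_cons !bumpS0 -[1%N]addn0 iotaDl -map_comp.
by congr (_ :: _); apply: eq_map => k /=; rewrite addnC addn1 !bumpSS.
Qed.

Section Lie.

Hypothesis skew : forall x y (f : X -> K),
  c x y * f (m x y) = - (c y x * f (m y x)).
Hypothesis jacobi : forall x y z (f : X -> K),
  c y z * c x (m y z) * f (m x (m y z))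
  = c x y * c (m x y) z * f (m (m x y) z)
    + c x z * c y (m x z) * f (m y (m x z)).

(** The Jacobi identity on each letter; the mixed terms, where the two actions
    hit different letters, cancel. *)
Lemma theta_comm x y F s :
  theta x (theta y F) s - theta y (theta x F) s = - (c x y * theta (m x y) F s).
Proof.
elim: s F => [|z s IH] F /=; first by rewrite mulr0 subr0 oppr0.
rewrite !(eq_theta _ (fun t => ins_theta _ z _ t)) !theta_lin.
have I := IH (ins z F); have J := jacobi x y z (fun u => F (u :: s)).
by apply: (eq_lin2 I (esym J)); rewrite /ins; ring.
Qed.

(** Induction on the word: Cartan's formula turns the defect on the first letter
    into the commutator of two Lie derivatives. *)
Lemma d_theta x F s : d (theta x F) s = theta x (d F) s.
Proof.
elim: s F => [|y s IH] F //=.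
rewrite (eq_d (fun t => ins_theta _ y _ t)) d_lin.
rewrite (eq_theta _ (fun t => ins_d y F t)) thetaD !thetaN -IH /ins.
apply: (eq_lin2 (theta_comm x y F s) (erefl 0)); ring.
Qed.

(** By Cartan's formula and [d_theta], d d commutes with contractions, so that
    it vanishes by induction on the length of the word. *)
Lemma dd_eq0 F s : d (d F) s = 0.
Proof.
elim: s F => //= x s IH F.
rewrite (eq_d (fun t => ins_d x F t)) dD !dN IH d_theta; ring.
Qed.

Lemma d_alternating F : alternating F -> alternating (d F).
Proof.
move=> aF s1; elim: s1 F aF => [|y s1 IH] F aF a b s2 /=.
  rewrite (eq_d (G := fun t => - ins a (ins b F) t)); last first.
    by move=> t; apply: (aF [::]).
  rewrite dN; have /= -> := skew a b (fun u => F (u :: s2)); rewrite /ins; ring.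
rewrite (theta_alternating y aF) (IH _ (alternating_ins y aF)); ring.
Qed.

End Lie.

Section Grading.
Variables (V : zmodType) (W : X -> V).
Hypothesis gradedP : forall x y, c x y != 0 -> W (m x y) = W x + W y.

Definition wt s := \sum_(x <- s) W x.

Lemma wt_cons x s : wt (x :: s) = W x + wt s.
Proof. by rewrite /wt big_cons. Qed.

Lemma wt_perm s t : perm_eq s t -> wt s = wt t.
Proof. by move=> st; rewrite /wt (perm_big _ st). Qed.

(** The bracket is graded, so that a function of the total degree passes through
    the action of a letter with its argument shifted by the degree of that
    letter. *)
Lemma theta_scale x (phi : V -> K) F s :
  theta x (fun t => phi (wt t) * F t) s = phi (W x + wt s) * theta x F s.
Proof.
have gen v : theta x (fun t => phi (v + wt t) * F t) s
           = phi (v + W x + wt s) * theta x F s.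
  elim: s v F => [|y s IH] v F /=; first by rewrite mulr0.
  rewrite mulrDr; congr (_ + _).
    have [->|cxy] := eqVneq (c x y) 0; first by rewrite !mul0r mulr0.
    by rewrite !wt_cons (gradedP cxy) !addrA; ring.
  rewrite (eq_theta _ (G := fun t => phi (v + W y + wt t) * ins y F t)) => [|t].
    by rewrite IH wt_cons; congr (phi _ * _); rewrite !addrA [v + W x + _]addrAC.
  by rewrite /ins wt_cons addrA.
have := gen 0; rewrite add0r => <-.
by apply: eq_theta => t; rewrite add0r.
Qed.

Lemma d_scale (phi : V -> K) F s :
  d (fun t => phi (wt t) * F t) s = phi (wt s) * d F s.
Proof.
elim: s phi F => [|x s IH] phi F /=; first by rewrite mulr0.
rewrite theta_scale wt_cons (eq_d (G := fun t => phi (W x + wt t) * ins x F t)).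
  by rewrite (IH (fun v => phi (W x + v))) /ins; ring.
by move=> t; rewrite /ins wt_cons.
Qed.

End Grading.

Lemma theta_diag x (e : X -> K) F s :
    (forall y, c x y = e y) -> (forall y, e y != 0 -> m x y = y) ->
  theta x F s = (\sum_(y <- s) e y) * F s.
Proof.
move=> ce my; elim: s F => [|y s IH] F /=; first by rewrite big_nil mul0r.
rewrite big_cons IH ce mulrDl; congr (_ + _).
by have [->|/my ->] := eqVneq (e y) 0; rewrite ?mul0r.
Qed.

End ChevalleyEilenberg.

(** * The annihilation algebra *)

Section Annihilation.
Variable K : numFieldType.

(** A letter is a generator of the conformal algebra with an exponent i. It
    stands for i! times the functional that takes the coefficient of the i-th
    power of the variable attached to that generator; with this factorial the
    bracket of two letters is a multiple of a single letter. *)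
Definition gen := ('I_4 * nat)%type.
Implicit Types p q r : gen.

Definition sv_tgt (u v : nat) : 'I_4 :=
  match u, v with
  | 0, 0 => svL
  | 0, 1 | 1, 0 => svN
  | 0, 2 | 2, 0 | 1, 2 | 2, 1 => svY
  | _, _ => svM
  end.

(** Whether the bracket is linear in ∂ and λ, in which case it lowers the sum of
    the exponents by one; otherwise it is constant. *)
Definition sv_low (u v : nat) : bool :=
  match u, v with 1, 2 | 2, 1 | 1, 3 | 3, 1 => false | _, _ => true end.

(** The bracket of the generators u and v is [sv_lam] λ - [sv_mu] (λ + ∂) +
    [sv_cst] times the generator [sv_tgt]. As λ and - λ - ∂ are the variables of
    u and v, each of them acts on letters by lowering the exponent of its own
    letter. *)
Definition sv_lam (u v : nat) : K :=
  match u, v with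
  | 0, 0 | 1, 0 | 2, 0 | 3, 0 | 2, 2 => 1
  | 0, 2 => 2^-1
  | _, _ => 0
  end.

Definition sv_mu (u v : nat) : K :=
  match u, v with
  | 0, _ | 2, 2 => - 1
  | 2, 0 => - 2^-1
  | _, _ => 0
  end.

Definition sv_cst (u v : nat) : K :=
  match u, v with
  | 1, 2 => 1
  | 2, 1 => - 1
  | 1, 3 => 2
  | 3, 1 => - 2
  | _, _ => 0
  end.

Definition sv_coef (p q : gen) : K :=
  sv_lam p.1 q.1 * p.2%:R + sv_mu p.1 q.1 * q.2%:R + sv_cst p.1 q.1.

Definition sv_ind (p q : gen) : gen :=
  (sv_tgt p.1 q.1, if sv_low p.1 q.1 then (p.2 + q.2).-1 else (p.2 + q.2)%N).

Lemma sv_skew p q (f : gen -> K) :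
  sv_coef p q * f (sv_ind p q) = - (sv_coef q p * f (sv_ind q p)).
Proof.
case: p q => [[[|[|[|[|]]]] //= hu] i] [[[|[|[|[|]]]] //= hv] j];
  rewrite /sv_coef /sv_ind /= ?[(j + i)%N]addnC; field; rewrite ?pnatr_eq0 //.
Qed.

Lemma sv_low_cst u v : sv_low u v -> sv_cst u v = 0.
Proof. by case: u v => [|[|[|[|u]]]] [|[|[|[|v]]]]. Qed.

Lemma sv_coef_low0 p q : sv_low p.1 q.1 -> (p.2 + q.2 = 0)%N -> sv_coef p q = 0.
Proof.
move=> low e0; have [p0 q0] : p.2 = 0%N /\ q.2 = 0%N by lia.
by rewrite /sv_coef sv_low_cst // p0 q0; ring.
Qed.

(** An index is lowered below zero only with a vanishing coefficient, so that
    in nested brackets truncated predecessors become true subtractions. *)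
Lemma sv_nestr p q r (f : gen -> K) (t := sv_tgt q.1 r.1) (b := sv_low q.1 r.1) :
  sv_coef q r * sv_coef p (sv_ind q r) * f (sv_ind p (sv_ind q r))
  = sv_coef q r * (sv_lam p.1 t * p.2%:R + sv_mu p.1 t * (q.2%:R + r.2%:R - b%:R)
                   + sv_cst p.1 t)
    * f (sv_tgt p.1 t, (p.2 + q.2 + r.2 - (b + sv_low p.1 t))%N).
Proof.
have [nz|nz] := boolP (b && (q.2 + r.2 == 0)%N).
  by case/andP: nz => lb /eqP e0; rewrite sv_coef_low0 // !mul0r.
have E : (sv_ind q r).2%:R = q.2%:R + r.2%:R - b%:R :> K.
  rewrite /sv_ind /= -/b -natrD; case: b nz => /= nz; last by rewrite subr0.
  by rewrite -subn1 natrB // lt0n.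
rewrite {2}/sv_coef E; congr (_ * f _); rewrite /sv_ind /= -/b -/t.
by congr (_, _); case: b nz {E}; case: sv_low => /=; lia.
Qed.

Lemma sv_nestl p q r (f : gen -> K) (t := sv_tgt p.1 q.1) (b := sv_low p.1 q.1) :
  sv_coef p q * sv_coef (sv_ind p q) r * f (sv_ind (sv_ind p q) r)
  = sv_coef p q * (sv_lam t r.1 * (p.2%:R + q.2%:R - b%:R) + sv_mu t r.1 * r.2%:R
                   + sv_cst t r.1)
    * f (sv_tgt t r.1, (p.2 + q.2 + r.2 - (b + sv_low t r.1))%N).
Proof.
have [nz|nz] := boolP (b && (p.2 + q.2 == 0)%N).
  by case/andP: nz => lb /eqP e0; rewrite sv_coef_low0 // !mul0r.
have E : (sv_ind p q).2%:R = p.2%:R + q.2%:R - b%:R :> K.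
  rewrite /sv_ind /= -/b -natrD; case: b nz => /= nz; last by rewrite subr0.
  by rewrite -subn1 natrB // lt0n.
rewrite {2}/sv_coef E; congr (_ * f _); rewrite /sv_ind /= -/b -/t.
by congr (_, _); case: b nz {E}; case: sv_low => /=; lia.
Qed.

Lemma sv_jacobi p q r (f : gen -> K) :
  sv_coef q r * sv_coef p (sv_ind q r) * f (sv_ind p (sv_ind q r))
  = sv_coef p q * sv_coef (sv_ind p q) r * f (sv_ind (sv_ind p q) r)
    + sv_coef p r * sv_coef q (sv_ind p r) * f (sv_ind q (sv_ind p r)).
Proof.
rewrite !sv_nestr sv_nestl [(q.2 + p.2)%N]addnC /sv_coef.
case: p q r => [[[|[|[|[|]]]] //= hu] i] [[[|[|[|[|]]]] //= hv] j]
  [[[|[|[|[|]]]] //= hw] k] /=; rewrite ?(mul0r, mulr0, add0r, addr0) //;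
  field; rewrite ?pnatr_eq0 //.
Qed.

End Annihilation.

Notation gL i := ((svL, i%N) : gen).
Notation gN i := ((svN, i%N) : gen).

Definition charge (p : gen) : int :=
  match val p.1 with 2 => 1 | 3 => 2 | _ => 0 end.

(** On a letter, twice the eigenvalue of minus the action of [gL 1]; it is
    doubled because Y has half-integral conformal weight. *)
Definition weight (p : gen) : int :=
  p.2%:Z * 2 - match val p.1 with 0 => 2 | 2 => 1 | _ => 0 end.

Section Gradings.
Variable K : numFieldType.
Implicit Types (F G : seq gen -> K) (s t : seq gen).

Local Notation theta := (theta (@sv_coef K) sv_ind).
Local Notation d := (differential (@sv_coef K) sv_ind).
Local Notation wedge := (@wedge K gen).
Local Notation cg := (wt charge).
Local Notation wg := (wt weight).

(** Multiplying a polynomial by the sum of its variables lowers one exponent at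
    a time; this is minus the action of [gL 0]. *)
Definition partial F s : K := - theta (gL 0) F s.

Lemma charge_graded p q : sv_coef K p q != 0 ->
  charge (sv_ind p q) = charge p + charge q.
Proof.
case: p q => [[[|[|[|[|]]]] //= hu] i] [[[|[|[|[|]]]] //= hv] j];
  by rewrite /sv_coef /sv_ind /charge /= ?(mul0r, addr0, eqxx).
Qed.

Lemma weight_graded p q : sv_coef K p q != 0 ->
  weight (sv_ind p q) = weight p + weight q.
Proof.
case: p q => [[[|[|[|[|]]]] //= hu] i] [[[|[|[|[|]]]] //= hv] j];
  rewrite /sv_coef /sv_ind /weight /= ?(mul0r, addr0, eqxx) //;
  case: i j => [|i] [|j]; rewrite ?(mulr0, addr0, eqxx) //= => _; lia.
Qed.

Lemma theta_N0 F s : theta (gN 0) F s = (cg s)%:~R * F s.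
Proof.
rewrite (theta_diag _ (e := fun p => (charge p)%:~R)).
- by rewrite /wt rmorph_sum.
- by case=> [[[|[|[|[|]]]] //= hu] i]; rewrite /sv_coef /charge /= ?mulr0; ring.
- by case=> [[[|[|[|[|]]]] //= hu] i]; rewrite /charge /= ?eqxx // => _;
    congr (_, _); apply: val_inj.
Qed.

Lemma theta_L1 F s : theta (gL 1) F s = - ((wg s)%:~R / 2 * F s).
Proof.
rewrite (theta_diag _ (e := fun p => - ((weight p)%:~R / 2))).
- by rewrite /wt rmorph_sum sumrN -mulr_suml mulNr.
- case=> [[[|[|[|[|]]]] //= hu] i]; rewrite /sv_coef /weight /=;
    rewrite ?(rmorphB, rmorphM) /=; field; rewrite ?pnatr_eq0 //.
- by case=> [[[|[|[|[|]]]] //= hu] i]; rewrite /sv_ind /= => _;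
    congr (_, _); apply: val_inj.
Qed.

Definition concentrated (V : zmodType) (W : gen -> V) (v : V) F :=
  forall s, F s != 0 -> wt W s = v.

Lemma concentratedE (V : zmodType) (W : gen -> V) v F : concentrated W v F ->
  F =1 (fun s => (wt W s == v)%:R * F s).
Proof.
move=> hF s; have [->|/hF ->] := eqVneq (F s) 0; first by rewrite mulr0.
by rewrite eqxx mul1r.
Qed.

Lemma concentrated_lin (V : zmodType) (W : gen -> V) v (k : K) F G :
  concentrated W v F -> concentrated W v G -> concentrated W v (fun s => k * F s + G s).
Proof.
move=> hF hG s; have [->|/hF //] := eqVneq (F s) 0.
by rewrite mulr0 add0r => /hG.
Qed.

Lemma concentratedD (V : zmodType) (W : gen -> V) v F G :
  concentrated W v F -> concentrated W v G -> concentrated W v (fun s => F s + G s).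
Proof.
by move=> hF hG s; have [->|/hF //] := eqVneq (F s) 0; rewrite add0r => /hG.
Qed.

Lemma concentrated_wedge (V : zmodType) (W : gen -> V) S :
  concentrated W (wt W S) (wedge S).
Proof. by move=> s /wedge_neq0 /wt_perm ->. Qed.

Lemma concentrated_d (V : zmodType) (W : gen -> V) v F :
    (forall p q, sv_coef K p q != 0 -> W (sv_ind p q) = W p + W q) ->
  concentrated W v F -> concentrated W v (d F).
Proof.
move=> gW /concentratedE hF s; rewrite (eq_d _ _ hF).
by rewrite (d_scale gW (fun u => (u == v)%:R)) /=; have [->//|_] := eqVneq (wt W s) v; rewrite mul0r eqxx.
Qed.

(** Up to permutation, the words in which every letter is L or N, no letter
    occurs twice, and the weights add up to zero: the letters of weight zero are
    [gL 1] and [gN 0], and [gL 0] can be compensated by [gL 2] or [gN 1] only. *)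
Definition basics : seq (seq gen) :=
  [:: [::]; [:: gL 1]; [:: gN 0]; [:: gL 1; gN 0];
      [:: gL 0; gL 2]; [:: gL 0; gL 2; gL 1]; [:: gL 0; gL 2; gN 0];
      [:: gL 0; gL 2; gL 1; gN 0];
      [:: gL 0; gN 1]; [:: gL 0; gN 1; gL 1]; [:: gL 0; gN 1; gN 0];
      [:: gL 0; gN 1; gL 1; gN 0] ].

Lemma charge_ge0 p : 0 <= charge p.
Proof. by rewrite /charge; case: p => [[[|[|[|[|]]]] //= hu] i]. Qed.

(** Among the letters of charge zero only [gL 0] has negative weight, so that it
    is the only source of cancellation in a word of weight zero. *)
Lemma weight_zero_perm s : uniq s -> cg s = 0 -> wg s = 0 ->
  exists2 S, S \in basics & perm_eq s S.
Proof.
move=> us cs ws.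
have sLN p : p \in s -> p.1 = svL \/ p.1 = svN.
  move=> ps; have : charge p = 0.
    move: cs; rewrite /wt (perm_big _ (perm_to_rem ps)) big_cons /= => /eqP.
    rewrite paddr_eq0 ?charge_ge0 ?sumr_ge0 // => [/andP[/eqP]//|q _].
    exact: charge_ge0.
  case: p {ps} => [[[|[|[|[|]]]] //= hu] i]; rewrite /charge //= => _.
    by left; apply: val_inj.
  by right; apply: val_inj.
have wP p : p \in s -> [\/ p = gL 0, p \in [:: gL 1; gN 0],
    p \in [:: gL 2; gN 1] | 4 <= weight p].
  move=> /sLN; case: p => u i /= [] ->; rewrite /weight /= !inE.
    case: i => [|[|[|i]]]; [by constructor 1|by constructor 2|by constructor 3|].
    by constructor 4; lia.
  case: i => [|[|i]]; [by constructor 2|by constructor 3|].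
  by constructor 4; lia.
pose z := filter (mem [:: gL 1; gN 0]) s.
pose v := filter (predC (mem [:: gL 1; gN 0])) s.
have svz : perm_eq s (v ++ z) by rewrite perm_sym perm_catC perm_filterC.
have zP : exists2 S, S \in [:: [::]; [:: gL 1]; [:: gN 0]; [:: gL 1; gN 0]]
    & perm_eq z S.
  exists (filter (mem z) [:: gL 1; gN 0]).
    by rewrite /=; case: ifP => _; case: ifP.
  apply: uniq_perm; rewrite ?filter_uniq // => p.
  by rewrite !mem_filter /= /z mem_filter /=; case: (p \in s); case: (p \in _).
have wz : wg z = 0.
  apply: big1_seq => q /=; rewrite mem_filter => /andP[+ _].
  by rewrite /= !inE => /orP[] /eqP ->.
have wv : wg v = 0.
  by move: ws; rewrite (wt_perm _ svz) /wt big_cat /= -/(wt _ z) wz addr0.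
have vP : v = [::] \/ perm_eq v [:: gL 0; gL 2] \/ perm_eq v [:: gL 0; gN 1].
  have uv : uniq v by rewrite filter_uniq.
  have pos (w : seq gen) : {subset w <= v} -> gL 0 \notin w ->
      forall p, p \in w -> p \in [:: gL 2; gN 1] \/ 4 <= weight p.
    move=> wv0 nw q qw; move: (wv0 _ qw); rewrite mem_filter /= => /andP[nq].
    case/wP; [|by rewrite (negPf nq)|by left|by right].
    by move=> qE; rewrite -qE qw in nw.
  have pos2 p : p \in [:: gL 2; gN 1] \/ 4 <= weight p -> 2 <= weight p.
    by case; [rewrite !inE => /orP[] /eqP ->|lia].
  have wge0 (w : seq gen) : {subset w <= v} -> gL 0 \notin w -> 0 <= wg w.
    move=> /pos/[apply] pw; rewrite /wt big_seq sumr_ge0 // => p /pw /pos2; lia.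
  case: (boolP (gL 0 \in v)) => v0; last first.
    left; case: (v) wv uv v0 wge0 pos => // p w + _ + wge0 pos.
    rewrite wt_cons inE negb_or => w0 /andP[np nw].
    have := @wge0 w (fun q => @mem_behead _ (p :: w) q) nw.
    have := pos (p :: w) (fun q h => h); rewrite inE negb_or np nw.
    by move=> /(_ isT p (mem_head _ _)) /pos2; lia.
  right; move: wv uv; rewrite (wt_perm _ (perm_to_rem v0)) (perm_uniq (perm_to_rem v0)).
  set w := rem _ v; rewrite wt_cons /= => w2 /andP[nw uw].
  have sw : {subset w <= v} by move=> q; apply: mem_rem.
  have := perm_to_rem v0; rewrite -/w.
  case E : w w2 => [|p w']; first by rewrite /wt big_nil /weight.
  rewrite wt_cons => w2.
  have pw : p \in w by rewrite E mem_head.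
  have wp := pos _ sw nw p pw.
  have w'0 : w' = [::].
    case: w' E w2 => // q w' E; rewrite wt_cons.
    have qw : q \in w by rewrite E !inE eqxx orbT.
    have := pos2 _ (pos _ sw nw q qw); have := pos2 _ wp.
    have sub : {subset w' <= w} by move=> r rw; rewrite E !inE rw !orbT.
    have := wge0 w' (fun r rw => sw r (sub r rw)) (contra (sub (gL 0)) nw).
    by rewrite /weight /=; lia.
  rewrite w'0 in w2 *; case: wp; last by move: w2; rewrite /wt big_nil /weight /=; lia.
  by rewrite !inE => /orP[] /eqP ->; [left|right].
case: zP => S S4 zS.
case: vP => [v0|[vS|vS]].
- exists S; last by rewrite v0 in svz; apply: perm_trans svz zS.
  by move: S4; rewrite !inE => /or4P[] /eqP ->.
- exists ([:: gL 0; gL 2] ++ S); last by rewrite (perm_trans svz) // perm_cat.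
  by move: S4; rewrite !inE => /or4P[] /eqP ->.
- exists ([:: gL 0; gN 1] ++ S); last by rewrite (perm_trans svz) // perm_cat.
  by move: S4; rewrite !inE => /or4P[] /eqP ->.
Qed.

(** An alternating function is determined up to sign by its values on one
    representative of each class of words modulo permutation. *)
Lemma weight_zero_eq0 F : alternating F -> concentrated charge 0 F -> concentrated weight 0 F ->
  (forall S, S \in basics -> F S = 0) -> forall s, F s = 0.
Proof.
move=> aF cF wF FS s; apply/eqP; apply: contraT => Fs.
have [S /FS FS0 sS] :=
  weight_zero_perm (alternating_uniq aF Fs) (cF _ Fs) (wF _ Fs).
by have [b] := alternating_perm aF sS; rewrite FS0 mulr0 => /eqP; rewrite (negPf Fs).
Qed.

(** Distinct basic words are not permutations of each other. *)
Lemma wedge_basics S T : S \in basics -> T \in basics ->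
  wedge S T = (S == T)%:R.
Proof.
have H : all uniq basics && all (fun S => all (fun T =>
   perm_eq T S ==> (S == T)) basics) basics.
  by vm_compute.
case/andP: H => /allP uS /allP H bS bT.
have [<-|ST] := eqVneq S T; first exact: wedge_diag (uS _ bS).
apply/eqP; apply: contraT => /wedge_neq0 TS.
by have /allP/(_ _ bT) := H _ bS; rewrite TS (negPf ST).
Qed.
End Gradings.

(** * Cochains of the annihilation algebra *)

Section Cochains.
Variable K : numFieldType.
Implicit Types (F G : seq gen -> K) (s t S T : seq gen).

Local Notation theta := (theta (@sv_coef K) sv_ind).
Local Notation d := (differential (@sv_coef K) sv_ind).
Local Notation wedge := (@wedge K gen).
Local Notation cg := (wt charge).
Local Notation wg := (wt weight).

(** The coefficient functions of polynomial cochains with [n - e] arguments;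
    the shift [e] makes sense of cochains with one argument less than [n] when
    [n] is zero. *)
Record cochain (e n : nat) F : Prop := Cochain {
  cochain_alternating : alternating F;
  cochain_size : forall s, F s != 0 -> (size s + e = n)%N;
  cochain_bounded : exists D : nat,
    forall s, F s != 0 -> all (fun p : gen => p.2 < D)%N s
}.

Lemma cochain_size0 e n F s : cochain e n F -> (size s + e != n)%N -> F s = 0.
Proof. by case=> _ sF _ se; apply/eqP; apply: contra_neqT se; apply: sF. Qed.

Lemma eq_cochain e n F G : F =1 G -> cochain e n F -> cochain e n G.
Proof.
move=> FG [aF sF [D bF]]; split.
- by move=> s1 a b s2; rewrite -!FG.
- by move=> s; rewrite -FG; apply: sF.
- by exists D => s; rewrite -FG; apply: bF.
Qed.

Lemma cochain_lin e n (k : K) F G :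
  cochain e n F -> cochain e n G -> cochain e n (fun s => k * F s + G s).
Proof.
move=> [aF sF [DF bF]] [aG sG [DG bG]]; split.
- exact: alternating_lin.
- move=> s; have [->|/sF //] := eqVneq (F s) 0.
  by rewrite mulr0 add0r => /sG.
- exists (maxn DF DG) => s; have [->|/bF + _] := eqVneq (F s) 0.
    rewrite mulr0 add0r => /bG; apply: sub_all => p /= /leq_trans; apply.
    exact: leq_maxr.
  by apply: sub_all => p /= /leq_trans; apply; apply: leq_maxl.
Qed.

Lemma cochain0 e n : cochain e n (fun=> 0).
Proof.
by split=> [s1 a b s2||]; [rewrite oppr0|move=> s|exists 0%N => s]; rewrite ?eqxx.
Qed.

Lemma cochainD e n F G :
  cochain e n F -> cochain e n G -> cochain e n (fun s => F s + G s).
Proof.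
move=> cF cG; apply: (@eq_cochain _ _ (fun s => 1 * F s + G s)).
  by move=> s; rewrite mul1r.
exact: cochain_lin.
Qed.

Lemma cochainZ e n (k : K) F : cochain e n F -> cochain e n (fun s => k * F s).
Proof.
move=> cF; apply: (@eq_cochain _ _ (fun s => k * F s + 0)).
  by move=> s; rewrite addr0.
exact: cochain_lin (cochain0 _ _).
Qed.

Lemma cochain_scale e n (V : zmodType) (W : gen -> V) (phi : V -> K) F :
  cochain e n F -> cochain e n (fun s => phi (wt W s) * F s).
Proof.
case=> aF sF [D bF]; split.
- by apply: alternating_scale aF => s t /wt_perm ->.
- by move=> s; rewrite mulf_eq0 negb_or => /andP[_ /sF].
- by exists D => s; rewrite mulf_eq0 negb_or => /andP[_ /bF].
Qed.

Lemma cochain_ins e n x F : cochain e n F -> cochain e.+1 n (ins x F).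
Proof.
case=> aF sF [D bF]; split; first exact: alternating_ins.
- by move=> s /sF /= <-; rewrite addnS addSn.
- by exists D => s /bF /= /andP[].
Qed.

Lemma cochain_pred e n F : cochain e.+1 n.+1 F -> cochain e n F.
Proof.
by case=> aF sF bF; split=> // s /sF; rewrite addnS => -[].
Qed.

Lemma cochain_wedge e S : cochain e (size S + e) (wedge S).
Proof.
split; first exact: alternating_wedge.
- by move=> s /wedge_neq0 /perm_size ->.
- exists (\max_(p <- S) p.2).+1 => s /wedge_neq0 /perm_all ->.
  by apply/allP => p pS; rewrite ltnS (@leq_bigmax_seq _ S xpredT (fun p => p.2)).
Qed.

Lemma theta_size x F s : (forall t, size t = size s -> F t = 0) -> theta x F s = 0.
Proof.
elim: s F => //= y s IH F F0.
by rewrite F0 // mulr0 add0r IH // => t ts; apply: F0; rewrite /= ts.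
Qed.

Lemma d_size F s : (forall t, (size t).+1 = size s -> F t = 0) -> d F s = 0.
Proof.
elim: s F => //= y s IH F F0; rewrite theta_size => [|t ts].
  by rewrite IH ?subr0 ?oppr0 // => t ts; apply: F0; rewrite /= ts.
by apply: F0; rewrite ts.
Qed.

(** * Cohomology in weight and charge zero *)

Section LowValues.
Variables (F : seq gen -> K) (aF : alternating F).

Lemma alternating_diag s1 x s2 : F (s1 ++ x :: x :: s2) = 0.
Proof.
by apply/eqP; apply: contraT => /(alternating_uniq aF); rewrite cat_uniq /= inE eqxx !andbF.
Qed.

Lemma d_1 x : d F [:: x] = 0.
Proof. by rewrite /= !oppr0 addr0. Qed.

Lemma d_L1N0 : d F [:: gL 1; gN 0] = 0.
Proof. by rewrite /= /sv_coef /=; ring. Qed.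

Lemma d_L0L2 : d F [:: gL 0; gL 2] = 2 * F [:: gL 1].
Proof. by rewrite /= /ins /sv_coef /sv_ind /=; ring. Qed.

Lemma d_L0N1 : d F [:: gL 0; gN 1] = F [:: gN 0].
Proof. by rewrite /= /ins /sv_coef /sv_ind /=; ring. Qed.

Lemma d_L0L2N0 : d F [:: gL 0; gL 2; gN 0] = 2 * F [:: gL 1; gN 0].
Proof. by rewrite /= /ins /sv_coef /sv_ind /=; ring. Qed.

Lemma d_L0L2L1 : d F [:: gL 0; gL 2; gL 1] = 0.
Proof.
have E1 := alternating_diag [::] (gL 1) [::].
have E2 := aF [::] (gL 2) (gL 0) [::].
rewrite /= /ins /sv_coef /sv_ind /=; apply: (eq_lin2 (congr1 ( *%R 2) E1) E2).
by rewrite /=; ring.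
Qed.

Lemma d_L0N1L1 : d F [:: gL 0; gN 1; gL 1] = - F [:: gL 1; gN 0].
Proof.
have E1 := aF [::] (gN 0) (gL 1) [::].
have E2 := aF [::] (gN 1) (gL 0) [::].
rewrite /= /ins /sv_coef /sv_ind /=; apply: (eq_lin2 E1 E2) => /=; ring.
Qed.

Lemma d_L0N1N0 : d F [:: gL 0; gN 1; gN 0] = 0.
Proof.
have E1 := alternating_diag [::] (gN 0) [::].
rewrite /= /ins /sv_coef /sv_ind /=; apply: (eq_lin2 E1 (erefl 0)) => /=; ring.
Qed.

Lemma d_L0L2L1N0 : d F [:: gL 0; gL 2; gL 1; gN 0] = 0.
Proof.
have E1 := alternating_diag [::] (gL 1) [:: gN 0].
have E2 := aF [::] (gL 2) (gL 0) [:: gN 0].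
rewrite /= /ins /sv_coef /sv_ind /=; apply: (eq_lin2 (congr1 ( *%R 2) E1) E2).
by rewrite /=; ring.
Qed.

Lemma d_L0N1L1N0 : d F [:: gL 0; gN 1; gL 1; gN 0] = 0.
Proof.
have E1 := alternating_diag [:: gL 1] (gN 0) [::].
have E2 := aF [::] (gN 0) (gL 1) [:: gN 0].
have E3 := aF [::] (gN 1) (gL 0) [:: gN 0].
rewrite /= /ins /sv_coef /sv_ind /=.
apply: (eq_lin2 (congr1 -%R E1) (congr2 +%R E2 E3)) => /=; ring.
Qed.

End LowValues.

Lemma eq_basics F G : alternating F -> alternating G ->
    concentrated charge 0 F -> concentrated charge 0 G ->
    concentrated weight 0 F -> concentrated weight 0 G ->
  (forall S, S \in basics -> F S = G S) -> F =1 G.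
Proof.
move=> aF aG cF cG wF wG FG s.
have := @weight_zero_eq0 K (fun t => -1 * G t + F t) (alternating_lin _ aG aF)
  (concentrated_lin cG cF) (concentrated_lin wG wF).
move=> H; have /eqP : -1 * G s + F s = 0.
  by apply: H => S /FG ->; rewrite mulN1r addNr.
by rewrite mulN1r addrC subr_eq0 => /eqP.
Qed.

(** Words whose dual cochains represent the cohomology before reduction. On
    basic words, the differential maps the dual of [gL 1] to twice that of [gL
    0; gL 2], the dual of [gN 0] to that of [gL 0; gN 1], and the dual of [gL 1;
    gN 0] to twice that of [gL 0; gL 2; gN 0] minus that of [gL 0; gN 1; gL 1];
    the other duals are cocycles. *)
Definition classes (n : nat) : seq (seq gen) :=
  match n with
  | 0 => [:: [::]]
  | 3 => [:: [:: gL 0; gL 2; gL 1]; [:: gL 0; gL 2; gN 0]; [:: gL 0; gN 1; gN 0]]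
  | 4 => [:: [:: gL 0; gL 2; gL 1; gN 0]; [:: gL 0; gN 1; gL 1; gN 0]]
  | _ => [::]
  end.

Lemma classes_basics n S : S \in classes n -> S \in basics.
Proof.
by case: n => [|[|[|[|[|n]]]]] //=; apply/allP.
Qed.

Lemma classes_size n S : S \in classes n -> size S = n.
Proof.
by case: n => [|[|[|[|[|n]]]]] //=; rewrite !inE;
  do ?[case/orP]; move=> /eqP ->.
Qed.

Lemma classes_charge n S : S \in classes n -> cg S = 0.
Proof.
move=> /classes_basics; suff /allP/(_ S)/[apply]/eqP : all (fun S => cg S == 0) basics by [].
by rewrite /wt /= !big_cons !big_nil.
Qed.

Lemma classes_weight n S : S \in classes n -> wg S = 0.
Proof.
move=> /classes_basics; suff /allP/(_ S)/[apply]/eqP : all (fun S => wg S == 0) basics by [].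
by rewrite /wt /= !big_cons !big_nil.
Qed.

(** The coordinate of a cocycle in the basis of [classes]. The extra term makes
    it vanish on the differential of the dual of [gL 1; gN 0]. *)
Definition class_coord S F : K :=
  F S + (if S == [:: gL 0; gL 2; gN 0] then 2 * F [:: gL 0; gN 1; gL 1] else 0).

Lemma class_coord_d n S F : S \in classes n -> alternating F ->
  class_coord S (d F) = 0.
Proof.
case: n => [|[|[|[|[|n]]]]] //=; rewrite !inE /class_coord.
- by move=> /eqP -> _; rewrite addr0.
- case/or3P => /eqP -> aF.
  + by rewrite addr0; apply: d_L0L2L1.
  + by rewrite eqxx d_L0L2N0 d_L0N1L1 //; ring.
  + by rewrite addr0; apply: d_L0N1N0.
- case/orP => /eqP -> aF; rewrite addr0.
  + exact: d_L0L2L1N0.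
  + exact: d_L0N1L1N0.
Qed.

Lemma class_coord_wedge n S T : S \in classes n -> T \in classes n ->
  class_coord S (wedge T) = (S == T)%:R.
Proof.
move=> nS nT; rewrite /class_coord (wedge_basics K) ?(classes_basics nS) ?(classes_basics nT) //.
rewrite [T == S]eq_sym; case: (S =P [:: gL 0; gL 2; gN 0]) => [_|]; last by rewrite addr0.
rewrite (wedge_basics K) ?(classes_basics nT) //.
suff -> : T == [:: gL 0; gN 1; gL 1] = false by rewrite mulr0 addr0.
by case: n nS nT => [|[|[|[|[|n]]]]] //= _; rewrite !inE; do ?[case/orP]; move=> /eqP ->.
Qed.

(** The differential preserves charge and weight, so that only its values on
    basic words with one more letter have to be checked. *)
Lemma d_wedge n S s : S \in classes n -> d (wedge S) s = 0.
Proof.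
move=> nS.
have aw := @alternating_wedge K _ S.
suff : d (wedge S) =1 (fun=> 0) by apply.
have z (V : zmodType) (W : gen -> V) : concentrated W 0 (fun=> 0 : K) by move=> t; rewrite eqxx.
have c0 : concentrated charge 0 (d (wedge S)).
  apply: concentrated_d; first exact: charge_graded.
  by rewrite -(classes_charge nS); apply: concentrated_wedge.
have w0 : concentrated weight 0 (d (wedge S)).
  apply: concentrated_d; first exact: weight_graded.
  by rewrite -(classes_weight nS); apply: concentrated_wedge.
apply: eq_basics => //.
- exact: d_alternating (@sv_skew K) _ aw.
- by move=> s1 a b s2; rewrite oppr0.
move=> T bT; have [sT|sT] := eqVneq (size T) n.+1; last first.
  apply: d_size => t tT; apply/eqP; apply: contra_neqT sT => /wedge_neq0 /perm_size.
  by rewrite (classes_size nS) -tT => ->.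
move: bT sT; rewrite !inE => /orP[|]; first by move=> /eqP ->.
case: n nS => [|[|[|[|[|n]]]]] // _;
  do 11?[case/orP]; move=> /eqP -> /eqP // _; rewrite ?d_1 //.
- exact: d_L0L2L1N0.
- exact: d_L0N1L1N0.
Qed.

(** In charge and weight zero the complex is spanned by the duals of the twelve
    basic words, with the differential described at [classes]. *)
Lemma finite_cohomology n F : cochain 0 n F ->
    concentrated charge 0 F -> concentrated weight 0 F -> (forall s, d F s = 0) ->
  exists2 g, cochain 1 n g &
    F =1 (fun s => d g s + \sum_(S <- classes n) class_coord S F * wedge S s).
Proof.
move=> cF chF wF dF.
have aF := cochain_alternating cF.
have two0 : 2 != 0 :> K by rewrite pnatr_eq0.
pose g s := match n with
  | 2 => F [:: gL 0; gL 2] / 2 * wedge [:: gL 1] s + F [:: gL 0; gN 1] * wedge [:: gN 0] s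
  | 3 => - F [:: gL 0; gN 1; gL 1] * wedge [:: gL 1; gN 0] s
  | _ => 0
  end.
have cg1 : cochain 1 n g.
  rewrite /g; case: (n) => [|[|[|[|k]]]]; try exact: cochain0.
    apply: cochain_lin; first exact: (cochain_wedge 1 [:: _]).
    by apply: cochainZ; apply: (cochain_wedge 1 [:: _]).
  by apply: cochainZ; apply: (cochain_wedge 1 [:: _; _]).
have ag := cochain_alternating cg1.
have gV (V : zmodType) (W : gen -> V) : W (gL 1) = 0 -> W (gN 0) = 0 -> concentrated W 0 g.
  move=> W1 W0; have z : concentrated W 0 (fun=> 0 : K) by move=> t; rewrite eqxx.
  have w1 : concentrated W 0 (wedge [:: gL 1]).
    by have := @concentrated_wedge K _ W [:: gL 1]; rewrite /wt big_seq1 W1.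
  have w0 : concentrated W 0 (wedge [:: gN 0]).
    by have := @concentrated_wedge K _ W [:: gN 0]; rewrite /wt big_seq1 W0.
  have w10 : concentrated W 0 (wedge [:: gL 1; gN 0]).
    have := @concentrated_wedge K _ W [:: gL 1; gN 0].
    by rewrite /wt big_cons big_seq1 W0 W1 addr0.
  rewrite /g; case: (n) => [|[|[|[|k]]]] // s.
    have := concentrated_lin (k := F [:: gL 0; gL 2] / 2) w1 (concentrated_lin (k := F [:: gL 0; gN 1]) w0 z).
    by move=> /(_ s); rewrite addr0.
  have := concentrated_lin (k := - F [:: gL 0; gN 1; gL 1]) w10 z.
  by move=> /(_ s); rewrite addr0.
have sV (V : zmodType) (W : gen -> V) : (forall S, S \in classes n -> wt W S = 0) ->
    concentrated W 0 (fun s => \sum_(S <- classes n) class_coord S F * wedge S s).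
  move=> W0 s Fs; apply/eqP; apply: contraT => Ws; move: Fs.
  rewrite big_seq big1 ?eqxx // => S nS.
  have [->|] := eqVneq (wedge S s) 0; first by rewrite mulr0.
  by move=> /(@concentrated_wedge K _ W) sW; rewrite sW W0 ?eqxx in Ws.
exists g => //; apply: eq_basics => //.
- apply: alternatingD; first exact: d_alternating (@sv_skew K) _ ag.
  apply: alternating_sum => S s1 a b s2.
  by rewrite (@alternating_wedge K) mulrN.
- apply: concentratedD; last by apply: sV => S; apply: classes_charge.
  by apply: concentrated_d; [apply: charge_graded|apply: gV].
- apply: concentratedD; last by apply: sV => S; apply: classes_weight.
  by apply: concentrated_d; [apply: weight_graded|apply: gV].
move=> S bS; have [sS|sS] := eqVneq (size S) n; last first.
  rewrite (cochain_size0 cF) ?addn0 // d_size => [|t tS]; last first.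
    by rewrite (cochain_size0 cg1) // addn1 tS.
  rewrite big_seq big1 ?addr0 // => T nT.
  have [->|/wedge_neq0/perm_size ST] := eqVneq (wedge T S) 0; first by rewrite mulr0.
  by rewrite ST (classes_size nT) eqxx in sS.
have -> : \sum_(T <- classes n) class_coord T F * wedge T S
        = \sum_(T <- classes n) (T == S)%:R * class_coord T F.
  rewrite !big_seq; apply: eq_bigr => T nT.
  by rewrite (wedge_basics K) ?(classes_basics nT) // mulrC.
move: bS sS; rewrite !inE; do 11?[case/orP]; move=> /eqP -> sS; subst n;
  rewrite (big_cons, big_nil) ?d_1 ?add0r; rewrite ?big_cons ?big_nil.
- by rewrite /class_coord /=; ring.
- by apply: (mulfI two0); rewrite -d_L0L2 dF mulr0.
- by rewrite -d_L0N1 dF.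
- rewrite d_L1N0 addr0 -[F _]opprK -(d_L0N1L1 aF) dF oppr0 //.
- by rewrite d_L0L2 /g /=; field; rewrite ?pnatr_eq0.
- by rewrite (d_L0L2L1 ag) /class_coord /=; ring.
- by rewrite d_L0L2N0 /g /class_coord /=; ring.
- by rewrite (d_L0L2L1N0 ag) /class_coord /=; ring.
- by rewrite d_L0N1 /g /=; ring.
- by rewrite (d_L0N1L1 ag) /g /class_coord /=; ring.
- by rewrite (d_L0N1N0 ag) /class_coord /=; ring.
- by rewrite (d_L0N1L1N0 ag) /class_coord /=; ring.
Qed.

End Cochains.

(** * The reduced complex *)

Section Reduced.
Variable K : numFieldType.
Implicit Types (F G : seq gen -> K) (s t S T : seq gen).

Local Notation theta := (theta (@sv_coef K) sv_ind).
Local Notation d := (differential (@sv_coef K) sv_ind).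
Local Notation wedge := (@wedge K gen).
Local Notation cg := (wt charge).
Local Notation wg := (wt weight).
Local Notation "∂" := (@partial K).

Lemma eq_partial F G : F =1 G -> ∂ F =1 ∂ G.
Proof. by move=> FG s; rewrite /partial (eq_theta _ _ _ FG). Qed.

Lemma partialD F G s : ∂ (fun t => F t + G t) s = ∂ F s + ∂ G s.
Proof. by rewrite /partial thetaD opprD. Qed.

Lemma partialN F s : ∂ (fun t => - F t) s = - ∂ F s.
Proof. by rewrite /partial thetaN. Qed.

Lemma partial_sum (I : Type) (r : seq I) (f : I -> seq gen -> K) s :
  ∂ (fun t => \sum_(i <- r) f i t) s = \sum_(i <- r) ∂ (f i) s.
Proof. by rewrite /partial theta_sum sumrN. Qed.

Lemma partialZ (k : K) F s : ∂ (fun t => k * F t) s = k * ∂ F s.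
Proof. by rewrite /partial thetaZ mulrN. Qed.

Lemma partial_cons u i F s :
  ∂ F ((u, i) :: s) = i%:R * F ((u, i.-1) :: s) + ∂ (ins (u, i) F) s.
Proof.
rewrite /partial /= opprD; congr (_ + _).
have -> : sv_ind (gL 0) (u, i) = (u, i.-1).
  by case: u => [[|[|[|[|]]]] //= hu]; rewrite /sv_ind /= add0n; congr (_, _); apply: val_inj.
suff -> : sv_coef K (gL 0) (u, i) = - i%:R by rewrite mulNr opprK.
by case: u => [[|[|[|[|]]]] //= hu]; rewrite /sv_coef /=; ring.
Qed.

Lemma d_partial F s : d (∂ F) s = ∂ (d F) s.
Proof. by rewrite /partial dN (d_theta (@sv_jacobi K)). Qed.

Lemma ins_L0_d F s : d F (gL 0 :: s) = ∂ F s - d (ins (gL 0) F) s.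
Proof. by []. Qed.

Lemma partial_weight (phi : int -> K) F s :
  ∂ (fun t => phi (wg t) * F t) s = phi (wg s - 2) * ∂ F s.
Proof.
by rewrite /partial (theta_scale (@weight_graded K)) mulrN /weight /= addrC.
Qed.

Lemma partial_charge (phi : int -> K) F s :
  ∂ (fun t => phi (cg t) * F t) s = phi (cg s) * ∂ F s.
Proof.
by rewrite /partial (theta_scale (@charge_graded K)) mulrN /charge /= add0r.
Qed.

Definition exps s := sumn [seq p.2 | p <- s].

Lemma partial_exps F s : (forall t, (exps t).+1 = exps s -> F t = 0) -> ∂ F s = 0.
Proof.
elim: s F => [|[u i] s IH] F F0; first by rewrite /partial /= oppr0.
rewrite partial_cons IH => [|t ts]; last by apply: F0; rewrite /exps /= -addnS -/(exps t) ts.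
case: i F0 => [|i] F0; first by rewrite mul0r addr0.
by rewrite F0 ?mulr0 ?addr0 // /exps /= addSn.
Qed.

(** Raising the first exponent expresses [F] through its values on words whose
    other exponents have a smaller sum. *)
Lemma partial_inj F : (forall s, ∂ F s = 0) -> forall x s, F (x :: s) = 0.
Proof.
move=> F0 [u i] s; have [k] := ubnP (exps s); elim: k u i s => // k IH u i s sk.
have := F0 ((u, i.+1) :: s); rewrite partial_cons partial_exps ?addr0.
  by move/eqP; rewrite mulf_eq0 pnatr_eq0 => /eqP.
by move=> t ts; apply: IH; rewrite ltnS in sk; rewrite ts.
Qed.

Lemma partial_neq0 F s : ∂ F s != 0 -> exists2 t, F t != 0 &
  [/\ size t = size s, cg t = cg s &
   forall D, all (fun p : gen => p.2 < D)%N t -> all (fun p : gen => p.2 < D.+1)%N s].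
Proof.
elim: s F => [|[u i] s IH] F; first by rewrite /partial /= oppr0 eqxx.
rewrite partial_cons.
have [->|F0] := eqVneq (F ((u, i.-1) :: s)) 0; last first.
  move=> _; exists ((u, i.-1) :: s) => //; split=> //; first by rewrite !wt_cons.
  move=> D /= /andP[iD sD]; apply/andP; split; first by lia.
  by apply: sub_all sD => p /= /ltnW.
rewrite mulr0 add0r => /IH [t Ft [ts tc tD]]; exists ((u, i) :: t) => //; split.
- by rewrite /= ts.
- by rewrite !wt_cons tc.
- by move=> D /= /andP[iD /tD ->]; rewrite ltnS ltnW.
Qed.

Lemma alternating_partial F : alternating F -> alternating (∂ F).
Proof. by move=> aF s1 a b s2; rewrite /partial theta_alternating. Qed.

Lemma cochain_partial e n F : cochain e n F -> cochain e n (∂ F).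
Proof.
case=> aF sF [D bF]; split.
- exact: alternating_partial.
- by move=> s /partial_neq0 [t /sF <- [-> _ _]].
- by exists D.+1 => s /partial_neq0 [t /bF + [_ _ h]] => /h.
Qed.

Lemma concentrated_partial F : concentrated charge 0 F -> concentrated charge 0 (∂ F).
Proof. by move=> cF s /partial_neq0 [t /cF <- [_ -> _]]. Qed.

(** Cartan's formula for [gL 1]: a cocycle is exact in each nonzero weight. *)
Lemma cocycle_L1 F : (forall s, d F s = 0) ->
  forall s, (wg s)%:~R / 2 * F s = d (ins (gL 1) F) s.
Proof.
move=> dF s; have /= := dF (gL 1 :: s).
by rewrite theta_L1 opprK => /eqP; rewrite subr_eq0 => /eqP.
Qed.

(** The value of ∂ F in weight 0 only depends on F in weight -2, where F is
    exact. *)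
Lemma partial_weight0 F s : (forall t, d F t = 0) -> wg s = 0 ->
  ∂ F s = - d (∂ (ins (gL 1) F)) s.
Proof.
move=> dF s0; rewrite d_partial -(eq_partial (cocycle_L1 dF)).
rewrite (partial_weight (fun w => w%:~R / 2)) s0 sub0r.
by rewrite -mulNr -[LHS]mul1r; congr (_ * _); rewrite rmorphN /=; field; rewrite ?pnatr_eq0.
Qed.

(** Cartan's formula for [gL 0]: the contraction of a cocycle is a cocycle
    modulo the image of ∂. This is the inverse of the connecting homomorphism of
    the long exact sequence. *)
Lemma d_ins_L0_wedge n S s : S \in classes n ->
  d (ins (gL 0) (wedge S)) s = ∂ (wedge S) s.
Proof.
move=> nS; have := ins_L0_d (wedge S) s; rewrite (d_wedge _ _ nS) => /eqP.
by rewrite eq_sym subr_eq0 => /eqP ->.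
Qed.

Lemma class_coord_lin T (k : K) F G :
  class_coord T (fun s => k * F s + G s) = k * class_coord T F + class_coord T G.
Proof. by rewrite /class_coord; case: eqP => _; ring. Qed.

Lemma class_coord_sum n (a : seq gen -> K) T : T \in classes n ->
  class_coord T (fun s => \sum_(S <- classes n) a S * wedge S s) = a T.
Proof.
move=> nT; transitivity (\sum_(S <- classes n) a S * class_coord T (wedge S)).
  rewrite /class_coord; case: eqP => _.
    by rewrite mulr_sumr -big_split; apply: eq_bigr => S _ /=; ring.
  by rewrite addr0; apply: eq_bigr => S _; rewrite addr0.
have un : uniq (classes n) by case: (n) => [|[|[|[|[|]]]]].
rewrite (bigD1_seq T) //= (class_coord_wedge _ nT nT) eqxx mulr1 big_seq_cond big1 ?addr0 //.
by move=> S /andP[nS ST]; rewrite (class_coord_wedge _ nT nS) eq_sym (negPf ST) mulr0.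
Qed.

Lemma class_coord_weight0 n T F G : T \in classes n ->
  (forall s, wg s = 0 -> F s = G s) -> class_coord T F = class_coord T G.
Proof.
move=> nT FG; rewrite /class_coord !FG // ?(classes_weight nT) //.
by rewrite /wt !big_cons big_nil.
Qed.

(** Applying d to a relation turns each contraction with [gL 0] into ∂ of a
    cocycle; as ∂ is injective this gives a relation in the unreduced
    cohomology, one degree higher, so that b vanishes. Then g' is a cocycle and
    ∂ g' is exact in weight 0, so that the other coordinates vanish too. *)
Lemma classes_independent n (a b : seq gen -> K) g g' :
    alternating g -> alternating g' ->
    (forall s, \sum_(S <- classes n) a S * wedge S s
             + \sum_(S <- classes n.+1) b S * ins (gL 0) (wedge S) s
             = d g s + ∂ g' s) ->
  (forall S, S \in classes n -> a S = 0) /\ (forall S, S \in classes n.+1 -> b S = 0).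
Proof.
move=> ag ag' E.
pose A s := \sum_(S <- classes n) a S * wedge S s.
pose B s := \sum_(S <- classes n.+1) b S * wedge S s.
have dA s : d A s = 0.
  rewrite d_sum big_seq big1 // => S nS; rewrite dZ (d_wedge _ _ nS) mulr0 //.
have dB s : d B s = 0.
  rewrite d_sum big_seq big1 // => S nS; rewrite dZ (d_wedge _ _ nS) mulr0 //.
have Bg : B =1 d g'.
  have P0 s : ∂ (fun t => B t - d g' t) s = 0.
    rewrite partialD partialN -!d_partial.
    have : d (fun t => A t + \sum_(S <- classes n.+1) b S * ins (gL 0) (wedge S) t) s
         = d (fun t => d g t + ∂ g' t) s by apply: eq_d => t; apply: E.
    rewrite !dD (dd_eq0 (@sv_jacobi K)) dA !add0r => <-.
    rewrite partial_sum d_sum big_seq [X in _ - X]big_seq -sumrB big1 // => S nS.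
    by rewrite partialZ dZ (d_ins_L0_wedge _ nS) subrr.
  case=> [|x s]; last by apply/eqP; rewrite -subr_eq0; apply/eqP/(partial_inj P0).
  rewrite /B big_seq big1 // => S nS.
  have [->|/wedge_neq0/perm_size/esym] := eqVneq (wedge S [::]) 0; first by rewrite mulr0.
  by rewrite (classes_size nS).
have b0 S : S \in classes n.+1 -> b S = 0.
  move=> nS; rewrite -(class_coord_sum b nS) -/B.
  by rewrite (class_coord_weight0 nS (fun s _ => Bg s)) (class_coord_d nS).
have dg' s : d g' s = 0.
  by rewrite -Bg /B big_seq big1 // => S /b0 ->; rewrite mul0r.
split=> // S nS; rewrite -(class_coord_sum a nS) -/A.
have AE s : wg s = 0 -> A s = -1 * d (∂ (ins (gL 1) g')) s + d g s.
  move=> s0; have := E s; rewrite [X in _ + X]big_seq [X in _ + X]big1 ?addr0 -/(A s).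
    by move->; rewrite (partial_weight0 dg' s0); ring.
  by move=> T /b0 ->; rewrite mul0r.
rewrite (class_coord_weight0 nS AE) class_coord_lin !(class_coord_d nS) ?mulr0 ?addr0 //.
exact/alternating_partial/alternating_ins.
Qed.
Lemma dd_sv F s : d (d F) s = 0.
Proof. exact: dd_eq0 (@sv_jacobi K) _ _. Qed.

(** Contraction with [gN 0] is a homotopy to multiplication by the charge and
    commutes with [∂]. *)
Lemma charge_homotopy z h s : (forall t, d z t = ∂ h t) ->
  (cg s)%:~R * z s = - (d (ins (gN 0) z) s + ∂ (ins (gN 0) h) s).
Proof.
move=> zh; have := zh (gN 0 :: s); rewrite /= theta_N0 partial_cons mul0r add0r => <-.
by ring.
Qed.

(** Contraction with [gL 1] is a homotopy to multiplication by the weight, but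
    commutes with [∂] only up to contraction with [gL 0]. *)
Lemma weight_homotopy z h s : (forall t, d z t = ∂ h t) ->
  (wg s)%:~R / 2 * z s = d (ins (gL 1) z) s + (∂ (ins (gL 1) h) s + ins (gL 0) h s).
Proof.
move=> zh; have := zh (gL 1 :: s); rewrite /= theta_L1 partial_cons /= mul1r opprK /ins.
by move=> /(canRL (subrK _)) ->; ring.
Qed.

(** As ∂ is injective, it suffices that ∂ d h = d d z = 0. *)
Lemma partial_primitive_cocycle z h : (forall t, d z t = ∂ h t) -> forall s, d h s = 0.
Proof.
move=> zh [//|x s]; apply: partial_inj => t.
by rewrite -d_partial -(eq_d _ _ zh) dd_sv.
Qed.

(** The two homotopies for [gL 1], applied to z and to h, make z trivial outside
    the weights 0 and 2. In weight 0, z is an honest cocycle modulo the image of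
    ∂; in weight 2, z is up to reduced coboundaries the contraction with [gL 0]
    of the weight 0 part of h. *)
Lemma spanning_charge0 n z h : cochain 0 n z -> cochain 0 n.+1 h ->
    concentrated charge 0 z -> concentrated charge 0 h -> (forall s, d z s = ∂ h s) ->
  exists g g' a b, [/\ cochain 1 n g, cochain 0 n g' &
    forall s, z s = \sum_(S <- classes n) a S * wedge S s
                  + \sum_(S <- classes n.+1) b S * ins (gL 0) (wedge S) s
                  + (d g s + ∂ g' s)].
Proof.
move=> cz ch qz qh zh; have dh := partial_primitive_cocycle zh.
have cLh : cochain 0 n (ins (gL 1) h) by apply/cochain_pred/cochain_ins.
(* In weight 0, ∂ h is minus the differential of the added term. *)
pose z0 s := (wg s == 0)%:R * (z s + ∂ (ins (gL 1) h) s).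
have cz0 : cochain 0 n z0.
  by apply: (cochain_scale weight (fun w => (w == 0)%:R)); apply/cochainD/cochain_partial.
have q0 F : concentrated weight 0 (fun s => (wg s == 0)%:R * F s).
  by move=> s; have [//|_] := eqVneq (wg s) 0; rewrite mul0r eqxx.
have qz0 : concentrated charge 0 z0.
  move=> s; rewrite mulf_eq0 negb_or => /andP[_]; move: s; apply: concentratedD => //.
  apply: concentrated_partial => s /qh; rewrite wt_cons add0r //.
have dz0 s : d z0 s = 0.
  rewrite (d_scale (@weight_graded K) (fun w => (w == 0)%:R)) dD zh.
  have [s0|_] := eqVneq (wg s) 0; last by rewrite mul0r.
  by rewrite (partial_weight0 dh s0) addNr mulr0.
have [g1 cg1 z0E] := finite_cohomology cz0 qz0 (@q0 _) dz0.
pose h0 s := (wg s == 0)%:R * h s.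
have ch0 : cochain 0 n.+1 h0 by apply: (cochain_scale weight (fun w => (w == 0)%:R)).
have qh0 : concentrated charge 0 h0.
  by move=> s; rewrite mulf_eq0 negb_or => /andP[_]; apply: qh.
have dh0 s : d h0 s = 0.
  by rewrite (d_scale (@weight_graded K) (fun w => (w == 0)%:R)) dh mulr0.
have [g2 cg2 h0E] := finite_cohomology ch0 qh0 (@q0 _) dh0.
have hE s : ins (gL 0) h0 s = \sum_(S <- classes n.+1) class_coord S h0 * ins (gL 0) (wedge S) s
   + (d (fun t => - ins (gL 0) g2 t) s + ∂ g2 s).
  by rewrite /ins (h0E (gL 0 :: s)) ins_L0_d dN; ring.
(* [phi] inverts the eigenvalue w / 2 on z; [psi] also inverts (w - 2) / 2,
   the eigenvalue on h of the word with [gL 0] in front. At w = 2 only [phi] is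
   needed, as the remaining term is the contraction of h0. *)
pose phi (w : int) : K := if w == 0 then 0 else 2 / w%:~R.
pose psi (w : int) : K := if w == 2 then 0 else phi w * (2 / (w - 2)%:~R).
exists (fun s => g1 s + (phi (wg s) * ins (gL 1) z s
   + (- psi (wg s) * ins (gL 0) (ins (gL 1) h) s - ins (gL 0) g2 s))).
exists (fun s => - (wg s + 2 == 0)%:R * ins (gL 1) h s
   + ((phi (wg s + 2) + psi (wg s + 2)) * ins (gL 1) h s + g2 s)).
exists (fun S => class_coord S z0), (fun S => class_coord S h0); split.
- apply: cochainD => //; apply: cochainD.
    by apply: cochain_scale; apply: cochain_ins.
  apply: cochainD; first apply: (cochain_scale weight (fun w => - psi w)).
    exact: cochain_ins.
  apply: (@eq_cochain _ _ _ (fun s => -1 * ins (gL 0) g2 s)).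
    by move=> s; rewrite mulN1r.
  by apply/cochainZ/cochain_pred/cochain_ins.
- apply: cochainD; first exact: (cochain_scale weight (fun w => - (w + 2 == 0)%:R)).
  apply: cochainD; first exact: (cochain_scale weight (fun w => phi (w + 2) + psi (w + 2))).
  exact: cochain_pred.
move=> s.
rewrite !dD !partialD (d_scale (@weight_graded K) phi).
rewrite (d_scale (@weight_graded K) (fun w => - psi w)).
rewrite (partial_weight (fun w => - (w + 2 == 0)%:R)).
rewrite (partial_weight (fun w => phi (w + 2) + psi (w + 2))) subrK.
have {}hE := hE s; have {}z0E := z0E s.
have E1 := weight_homotopy s zh.
have E2 := cocycle_L1 dh (gL 0 :: s); rewrite ins_L0_d in E2.
move: hE z0E E1 E2; rewrite /h0 /z0 /ins wt_cons -[weight (gL 0)]/(- 2%:Z).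
set A := \sum_(S <- classes n) _; set B := \sum_(S <- classes n.+1) _.
move=> hE z0E E1 E2.
rewrite !dN in hE *.
move: hE z0E E1 E2.
set P := ∂ (fun t => h _) s; set DK := d (fun t => z _) s; set Q := d (fun t => h _) s.
set R := d _ s; set P2 := ∂ g2 s; set H := h _; set D1 := d g1 s; set Z := z s.
rewrite /psi /phi; move: (wg s) => w.
clearbody A B P DK Q R P2 H D1 Z.
rewrite addrC => hE z0E E1 E2.
have HE : B = (w - 2 == 0)%:R * H + R - P2 by rewrite hE; ring.
have ZE : A = (w == 0)%:R * (Z + P) - D1 by rewrite z0E; ring.
rewrite HE ZE {hE z0E HE ZE A B} subr_eq0.
have [->|w0] := eqVneq w 0; first by rewrite /=; ring.
have [w2|w2] := eqVneq w 2.
  have -> : Z = DK + (P + H) by rewrite -E1 w2; field; rewrite ?pnatr_eq0.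
  by rewrite w2 /=; field; rewrite ?pnatr_eq0.
have wK : w%:~R != 0 :> K by rewrite intr_eq0.
have w2K : w%:~R - 2 != 0 :> K.
  by rewrite -[2]/(2%:~R) -rmorphB /= intr_eq0 subr_eq0.
have PQ : P = (w%:~R - 2) / 2 * H + Q.
  by move: E2; rewrite rmorphB /= => ->; ring.
have -> : DK = w%:~R / 2 * Z - (P + H) by rewrite E1; ring.
rewrite rmorphB /= PQ; field; by apply/andP; split.
Qed.

(** Twofold reduction: to charge 0 by contraction with [gN 0], then to the
    weights 0 and 2 by contraction with [gL 1]. *)
Theorem classes_spanning n z h : cochain 0 n z -> cochain 0 n.+1 h ->
    (forall s, d z s = ∂ h s) ->
  exists g g' a b, [/\ cochain 1 n g, cochain 0 n g' &
    forall s, z s = \sum_(S <- classes n) a S * wedge S s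
                  + \sum_(S <- classes n.+1) b S * ins (gL 0) (wedge S) s
                  + (d g s + ∂ g' s)].
Proof.
move=> cz ch zh.
pose phi (v : int) : K := if v == 0 then 0 else - (v%:~R)^-1.
have q0 F : concentrated charge 0 (fun s => (cg s == 0)%:R * F s).
  by move=> s; have [//|_] := eqVneq (cg s) 0; rewrite mul0r eqxx.
have [||||s|g [g' [a [b [cg1 cg2 E]]]]] := @spanning_charge0 n
  (fun s => (cg s == 0)%:R * z s) (fun s => (cg s == 0)%:R * h s).
- exact: (cochain_scale charge (fun v => (v == 0)%:R)).
- exact: (cochain_scale charge (fun v => (v == 0)%:R)).
- exact: q0.
- exact: q0.
- rewrite (d_scale (@charge_graded K) (fun v => (v == 0)%:R)).
  by rewrite (partial_charge (fun v => (v == 0)%:R)) zh.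
exists (fun s => g s + phi (cg s) * ins (gN 0) z s).
exists (fun s => g' s + phi (cg s) * ins (gN 0) h s), a, b; split.
- by apply: cochainD => //; apply: cochain_scale; apply: cochain_ins.
- apply: cochainD => //; apply: cochain_scale.
  by apply/cochain_pred/cochain_ins.
move=> s; rewrite dD partialD (d_scale (@charge_graded K)) partial_charge.
rewrite [X in _ = _ + X]addrACA [RHS]addrA -E -mulrDr.
have := charge_homotopy s zh; rewrite /phi.
have [-> _|c0] := eqVneq (cg s) 0; first by rewrite mul0r mul1r addr0.
move=> /(congr1 -%R); rewrite opprK => <-; rewrite mul0r add0r mulrNN mulKf ?intr_eq0 //.
Qed.

End Reduced.

(** * Taylor coefficients of polynomials *)

Section Polynomials.
Variable K : numFieldType.

Section Evaluation.
Variable n : nat.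
Local Notation P := {mpoly K[n]}.

Definition pev (x : P) : {poly K} -> P :=
  horner_eval x \o map_poly (@mpolyC n K).
HB.instance Definition _ x := GRing.RMorphism.copy (pev x)
  (horner_eval x \o map_poly (@mpolyC n K)).

Lemma pevX x : pev x 'X = x.
Proof. by rewrite /pev /= map_polyX /horner_eval hornerX. Qed.

Lemma pevC x c : pev x c%:P = c%:MP.
Proof. by rewrite /pev /= map_polyC /= /horner_eval hornerC. Qed.

Definition pev2 (D x : P) : {poly {poly K}} -> P :=
  horner_eval x \o map_poly (pev D).
HB.instance Definition _ D x := GRing.RMorphism.copy (pev2 D x)
  (horner_eval x \o map_poly (pev D)).

Lemma pev2X D x : pev2 D x 'X = x.
Proof. by rewrite /pev2 /= map_polyX /horner_eval hornerX. Qed.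

Lemma pev2C D x f : pev2 D x f%:P = pev D f.
Proof. by rewrite /pev2 /= map_polyC /= /horner_eval hornerC. Qed.

Lemma pev2_lift D x f p : pev2 D x (f^:P \Po p) = pev (pev2 D x p) f.
Proof.
elim/poly_ind: f => [|f c IHf]; first by rewrite !rmorph0.
rewrite !rmorphD !rmorphM /= pevX pevC map_polyX map_polyC /= comp_polyX.
by rewrite comp_polyC IHf pev2C pevC.
Qed.

Lemma pev2_sum D x N (p : {poly {poly K}}) : (size p <= N)%N ->
  \sum_(k < N) x ^+ k * pev D p`_k = pev2 D x p.
Proof.
move=> le_pN; rewrite /pev2 /= /horner_eval (@horner_coef_wide _ N) //.
  by apply: eq_bigr => k _; rewrite coef_map mulrC.
by apply: leq_trans le_pN; apply: size_poly.
Qed.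

Lemma pev2_coord D x a b l : pev2 D x (sv_coord a b l) =
  \sum_i \sum_j pev (- x) (a 0 i) * pev (D + x) (b 0 j)
                * pev2 D x (sv_table K i j 0 l).
Proof.
rewrite rmorph_sum; apply: eq_bigr => i _; rewrite rmorph_sum.
apply: eq_bigr => j _; rewrite !rmorphM /= !pev2_lift.
by rewrite rmorphN rmorphD /= pev2X pev2C pevX.
Qed.

Lemma pev2_table (D x : P) (i j l : 'I_4) :
  pev2 D x (sv_table K i j 0 l)
  = if l == sv_tgt i j then
      (sv_lam K i j)%:MP * x - (sv_mu K i j)%:MP * (D + x) + (sv_cst K i j)%:MP
    else 0.
Proof.
have h32 : 3 / 2 = 1 + 2^-1 :> K by field; rewrite ?pnatr_eq0.
case: i => [[|[|[|[|]]]] //= ?]; case: j => [[|[|[|[|]]]] //= ?];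
  case: l => [[|[|[|[|]]]] //= ?]; rewrite /sv_table /sv_half /=;
  rewrite !mxE /= ?mulr0 ?mulr1 ?comp_poly0 ?oppr0 ?rmorph0 ?rmorph1 //.
all: rewrite ?comp_polyD ?comp_polyM ?comp_polyX ?comp_polyC ?rmorph_nat ?h32.
all: rewrite ?(rmorphD, rmorphN, rmorphM, rmorph1, rmorph_nat) /=.
all: rewrite ?(rmorphD, rmorphN, rmorphM, rmorph1, rmorph_nat) /=.
all: rewrite ?(pev2X, pev2C, pevX, pevC) ?(rmorphN, rmorph1, rmorph0, rmorph_nat) //=.
all: try ring.
Qed.

(** The value at 0 of the derivative of multi-index m. *)
Definition taylor (m : 'X_{1..n}) (q : P) : K := q@_m * (\prod_i (m i)`!)%:R.

Lemma taylor_lin m (c : K) p q : taylor m (c *: p + q) = c * taylor m p + taylor m q.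
Proof. by rewrite /taylor mcoeffD mcoeffZ; ring. Qed.

Lemma taylorD m p q : taylor m (p + q) = taylor m p + taylor m q.
Proof. by rewrite /taylor mcoeffD mulrDl. Qed.

Lemma taylorZ m (c : K) p : taylor m (c *: p) = c * taylor m p.
Proof. by rewrite /taylor mcoeffZ mulrA. Qed.

Lemma taylor_sum m (I : Type) (r : seq I) (Q : pred I) (f : I -> P) :
  taylor m (\sum_(i <- r | Q i) f i) = \sum_(i <- r | Q i) taylor m (f i).
Proof. by rewrite /taylor raddf_sum mulr_suml. Qed.

Lemma taylor_eq0 m p : taylor m p = 0 -> p@_m = 0.
Proof.
move=> /eqP; rewrite mulf_eq0 pnatr_eq0 => /orP[/eqP//|].
by rewrite -leqn0 leqNgt prodn_gt0 // => i; apply: fact_gt0.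
Qed.

(** Leibniz rule at the origin. *)
Lemma taylor_X m i q : taylor m ('X_i * q) = (m i)%:R * taylor (m - U_(i))%MM q.
Proof.
case mi : (m i) => [|k]; rewrite /taylor.
  rewrite mul0r [q]mpolyE mulr_sumr raddf_sum /= big1 ?mul0r // => u _.
  rewrite -scalerAr -mpolyXD mcoeffZ mcoeffX; case: eqP => [/mnmP/(_ i)|_]; last by rewrite mulr0.
  by rewrite mnmDE mnm1E eqxx mi.
have Um : (U_(i) <= m)%MM by rewrite lep1mP mi.
have -> : ('X_i * q)@_m = q@_(m - U_(i)).
  by rewrite -{1}(submK Um) addmC mulrC mcoeffMX.
rewrite mulrCA; congr (_ * _).
rewrite -natrM; congr (_%:R); rewrite !(bigD1 i (P := xpredT)) //= mnmBE mnm1E eqxx mi subn1 mulnA -factS.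
congr (_ * _)%N; apply: eq_bigr => j ji.
by rewrite mnmBE mnm1E eq_sym (negPf ji) subn0.
Qed.

End Evaluation.

Lemma pev_comp n k (x : {mpoly K[n]}) (t : n.-tuple {mpoly K[k]}) f :
  pev x f \mPo t = pev (x \mPo t) f.
Proof.
elim/poly_ind: f => [|f c IHf]; first by rewrite !rmorph0.
by rewrite !rmorphD !rmorphM /= !pevX !pevC comp_mpolyC IHf.
Qed.

(** * Substituting a sum of two variables *)

Section Contract.
Variables (n : nat) (i j : 'I_n.+1).
Hypothesis ij : (i < j)%N.

Definition ctuple : n.-tuple {mpoly K[n.+1]} :=
  [tuple contract i j ('X_i + 'X_j) (fun l => 'X_l) l | l < n].

Definition cmon (m : 'X_{1..n.+1}) : 'X_{1..n} :=
  [multinom contract i j (m i + m j)%N m l | l < n].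

Lemma cmonE m l : cmon m l = contract i j (m i + m j)%N m l.
Proof. exact: mnmE. Qed.

Definition skip (k : nat) : 'I_n.+1 := inord (bump j (bump i k)).

Lemma skipE k : (k.+1 < n)%N -> skip k = bump j (bump i k) :> nat.
Proof. by move=> kn; rewrite inordK // /bump; lia. Qed.

Lemma skip_neq k : (k.+1 < n)%N -> (skip k != i) && (skip k != j).
Proof. by move: ij => ij' kn; rewrite -!val_eqE /= skipE // /bump; lia. Qed.

Lemma skip_inj k k' : (k.+1 < n)%N -> (k'.+1 < n)%N -> (skip k == skip k') = (k == k').
Proof.
by move=> kn kn'; rewrite -val_eqE /= !skipE // /bump; lia.
Qed.

Lemma skip_surj p : p != i -> p != j -> exists2 k, (k.+1 < n)%N & p = skip k.
Proof.
move=> pi pj; exists (unbump i (unbump j p)).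
  by move: ij pi pj (ltn_ord p) (ltn_ord j); rewrite -!val_eqE /= /unbump; lia.
apply/val_inj; rewrite /= skipE; move: ij pi pj (ltn_ord p) (ltn_ord j);
  rewrite -!val_eqE /= /unbump /bump; lia.
Qed.

Lemma contract0P : exists2 o : 'I_n, val o = 0%N &
  forall (T : Type) (x : T) a, contract i j x a o = x.
Proof.
have n0 : (0 < n)%N by move: ij (ltn_ord i) (ltn_ord j); lia.
by exists (Ordinal n0).
Qed.

(** The chain rule: the derivatives of p (x_i + x_j, ...) with respect to x_i
    and to x_j are both the derivative of p in its first argument, so that the
    two exponents add up. *)
Lemma taylor_contract m (p : {mpoly K[n]}) :
  taylor m (p \mPo ctuple) = taylor (cmon m) p.
Proof.
have cX l q : (forall m, taylor m (q \mPo ctuple) = taylor (cmon m) q) ->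
    forall m, taylor m (('X_l * q) \mPo ctuple) = taylor (cmon m) ('X_l * q).
  move=> IH {}m; rewrite rmorphM /= comp_mpolyXU taylor_X cmonE -tnth_nth tnth_mktuple /contract.
  case: l => [[|k] kn] /=.
    have sub u : u = i \/ u = j -> m u != 0%N ->
        cmon (m - U_(u)) = (cmon m - U_(Ordinal kn))%MM.
      move=> uij mu; apply/mnmP => -[[|l] ln]; rewrite mnmBE mnm1E !cmonE /contract /=.
        have ji : (j == i) = false by rewrite -val_eqE /= gtn_eqF.
        have ij' : (i == j) = false by rewrite -val_eqE /= ltn_eqF.
        rewrite !mnmBE !mnm1E.
        case: uij mu => -> mu; rewrite eqxx ?ji ?ij' /=; lia.
      rewrite ?mnmBE ?mnm1E -[inord _]/(skip l).
      have /andP[/negPf si /negPf sj] := skip_neq ln.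
      by case: uij => ->; rewrite [_ == skip l]eq_sym ?si ?sj.
    rewrite mulrDl taylorD !taylor_X !IH natrD mulrDl; congr (_ + _).
      by have [->|mi] := eqVneq (m i) 0%N; rewrite ?mul0r // sub //; left.
    by have [->|mj] := eqVneq (m j) 0%N; rewrite ?mul0r // sub //; right.
  rewrite -[inord _]/(skip k) taylor_X IH.
  have [->|mk] := eqVneq (m (skip k)) 0%N; first by rewrite !mul0r.
  congr (_ * taylor _ _); apply/mnmP => -[[|l] ln]; rewrite mnmBE mnm1E !cmonE /contract /=.
    have /andP[/negPf si /negPf sj] := skip_neq kn.
    by rewrite !mnmBE !mnm1E si sj !subn0.
  by rewrite ?mnmBE ?mnm1E -[inord _]/(skip l) skip_inj.
elim/mpolyind: p m => [|c u p _ _ IH] m; first by rewrite rmorph0 /taylor !mcoeff0 !mul0r.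
rewrite linearP /= !taylor_lin IH; congr (_ * _ + _).
move: m; rewrite mpolyXE_id; elim: (index_enum _) => [|l r IHr] m.
  rewrite big_nil rmorph1 /taylor !mcoeff1.
  have -> : (cmon m == 0%MM) = (m == 0%MM).
    apply/eqP/eqP => [/mnmP c0|->]; apply/mnmP => l.
      have [o o0 oE] := contract0P; have := c0 o; rewrite cmonE oE mnm0E => /eqP.
      rewrite addn_eq0 => /andP[/eqP mi /eqP mj]; rewrite mnm0E.
      have [->//|li] := eqVneq l i; have [->//|lj] := eqVneq l j.
      have [k kn ->] := skip_surj li lj.
      by have := c0 (Ordinal kn); rewrite cmonE mnm0E.
    by rewrite cmonE /contract; case: (val l) => [|k]; rewrite !mnm0E.
  have [->|] := eqVneq m 0%MM; last by rewrite !mul0r.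
  rewrite !big1 // => l _; rewrite ?mnm0E // cmonE /contract.
  by case: (val l) => [|k]; rewrite !mnm0E.
rewrite big_cons; elim: (u l) m => [|k IHk] m; first by rewrite expr0 mul1r IHr.
by rewrite exprS -mulrA cX.
Qed.
End Contract.

End Polynomials.

Lemma sv_high_coef0 (K : numFieldType) u v : ~~ sv_low u v -> (sv_lam K u v = 0) * (sv_mu K u v = 0).
Proof. by case: u v => [|[|[|[|u]]]] [|[|[|[|v]]]]. Qed.

(** * From polynomial cochains to their Taylor coefficients *)

Section Sesquilinear.
Variable K : numFieldType.
Local Notation A := (extended_SV K).

(** Linearity and the rule for ∂ in one formula, [pev (- 'X_i) f] being the
    action of a polynomial f in ∂ on the i-th argument. *)
Definition sesqui n (g : precochain A n) := forall a i (f : {poly K}) (x y : A),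
  g (upd a i (f *: x + y)) = pev (- 'X_i) f * g (upd a i x) + g (upd a i y).

Lemma upd_upd n (a : {ffun 'I_n -> A}) i x y : upd (upd a i x) i y = upd a i y.
Proof. by apply/ffunP => k; rewrite !ffunE; case: eqP. Qed.

Lemma upd_id n (a : {ffun 'I_n -> A}) i : upd a i (a i) = a.
Proof. by apply/ffunP => k; rewrite ffunE; case: eqP => [->|]. Qed.

Lemma updE n (a : {ffun 'I_n -> A}) i x : upd a i x i = x.
Proof. by rewrite ffunE eqxx. Qed.

Lemma upd_neq n (a : {ffun 'I_n -> A}) i x k : k != i -> upd a i x k = a k.
Proof. by move=> ki; rewrite ffunE (negPf ki). Qed.

Lemma sesqui0 n (g : precochain A n) : sesqui g -> forall a i, g (upd a i 0) = 0.
Proof.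
move=> sg a i; have := sg a i 1 0 0; rewrite scaler0 addr0 rmorph1 mul1r.
by move=> /eqP; rewrite -subr_eq subrr eq_sym => /eqP.
Qed.

Lemma is_cochain_sesqui n (g : precochain A n) : is_cochain g -> sesqui g.
Proof.
case=> lin ses _ a i f x y.
have D u v : g (upd a i (u + v)) = g (upd a i u) + g (upd a i v).
  by have := lin a i 1 u v; rewrite !scale1r.
have X u : g (upd a i ('X *: u)) = - 'X_i * g (upd a i u).
  by have := ses (upd a i u) i; rewrite upd_upd updE.
have C (c : K) u : g (upd a i (c%:P *: u)) = c *: g (upd a i u).
  have := lin a i c u 0; rewrite addr0 => ->.
  suff -> : g (upd a i 0) = 0 by rewrite addr0.
  by have /eqP := D 0 0; rewrite addr0 -subr_eq subrr eq_sym => /eqP.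
rewrite D; congr (_ + _); elim/poly_ind: f => [|f c IHf] in x *.
  by rewrite -polyC0 C scale0r rmorph0 mul0r.
rewrite scalerDl -scalerA D IHf X C rmorphD rmorphM /= pevX pevC -mul_mpolyC; ring.
Qed.

Lemma sesqui_is_cochain n (g : precochain A n) : sesqui g ->
  (forall (a : {ffun 'I_n -> A}) (s : 'S_n),
    g [ffun k => a (s k)] \mPo [tuple 'X_(s k) | k < n] = (-1) ^+ s *: g a) ->
  is_cochain g.
Proof.
move=> sg skew; split=> // [a i c x y|a i].
  by rewrite sg pevC mul_mpolyC.
have := sg a i 'X (a i) 0; rewrite addr0 pevX (sesqui0 sg) addr0 upd_id; exact.
Qed.

Lemma sesqui_lin n (c : K) (g h : precochain A n) : sesqui g -> sesqui h ->
  sesqui (fun a => c *: g a + h a).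
Proof. by move=> sg sh a i f x y; rewrite sg sh -!mul_mpolyC; ring. Qed.

Lemma sesquiB n (g h : precochain A n) : sesqui g -> sesqui h ->
  sesqui (fun a => g a - h a).
Proof. by move=> sg sh a i f x y; rewrite sg sh; ring. Qed.

Lemma sesqui_sum n (I : Type) (r : seq I) (c : I -> K) (g : I -> precochain A n) :
  (forall i, sesqui (g i)) -> sesqui (fun a => \sum_(i <- r) c i *: g i a).
Proof.
move=> sg a i f x y; rewrite mulr_sumr -big_split; apply: eq_bigr => k _ /=.
by rewrite sg -!mul_mpolyC; ring.
Qed.

Lemma sesqui_del n (g : precochain A n) : sesqui g -> sesqui (del g).
Proof. by move=> sg a i f x y; rewrite /del sg; ring. Qed.

Definition base (l : 'I_4) : A := delta_mx 0 l.

Lemma sesqui_expand n (g : precochain A n) a i (x : A) : sesqui g ->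
  g (upd a i x) = \sum_l pev (- 'X_i) (x 0 l) * g (upd a i (base l)).
Proof.
move=> sg; rewrite {1}[x](row_sum_delta x).
elim: (index_enum _) => [|l r IH]; first by rewrite !big_nil (sesqui0 sg).
by rewrite !big_cons sg IH.
Qed.

Definition gen0 : gen := gL 0.

Definition gens n (s : seq gen) : {ffun 'I_n -> A} :=
  [ffun k : 'I_n => base (nth gen0 s k).1].

Definition mono n (s : seq gen) : 'X_{1..n} := [multinom (nth gen0 s k).2 | k < n].

Lemma gensE n s k : gens n s k = base (nth gen0 s k).1.
Proof. by rewrite ffunE. Qed.

(** A word lists the generators put into the cochain together with the multi-
    index of the Taylor coefficient. *)
Definition coef n (g : precochain A n) (s : seq gen) : K :=
  if size s == n then taylor (mono n s) (g (gens n s)) else 0.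

Lemma coef_lin n (c : K) (g h : precochain A n) s :
  coef (fun a => c *: g a + h a) s = c * coef g s + coef h s.
Proof. by rewrite /coef; case: eqP => _; rewrite ?taylor_lin // mulr0 addr0. Qed.

Lemma coef_sum n (I : Type) (r : seq I) (c : I -> K) (g : I -> precochain A n) s :
  coef (fun a => \sum_(i <- r) c i *: g i a) s = \sum_(i <- r) c i * coef (g i) s.
Proof.
rewrite /coef; case: eqP => _; last by rewrite big1 // => i _; rewrite mulr0.
by rewrite taylor_sum; apply: eq_bigr => i _; rewrite taylorZ.
Qed.

(** Sesquilinearity reduces to arguments that are generators; there the Taylor
    coefficients determine the polynomial. *)
Lemma sesqui_eq0 n (g : precochain A n) : sesqui g ->
  (forall s, size s = n -> coef g s = 0) -> forall a, g a = 0.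
Proof.
move=> sg g0.
have gb (t : {ffun 'I_n -> 'I_4}) : g [ffun k => base (t k)] = 0.
  apply/mpolyP => m; rewrite mcoeff0; apply: taylor_eq0.
  pose s := [seq (t k, m k) | k <- enum 'I_n].
  have ss : size s = n by rewrite size_map size_enum_ord.
  have sk (k : 'I_n) : nth gen0 s k = (t k, m k).
    by rewrite (nth_map k) ?size_enum_ord // nth_ord_enum.
  have := g0 s ss; rewrite /coef ss eqxx.
  have -> : gens n s = [ffun k => base (t k)] by apply/ffunP => k; rewrite !ffunE sk.
  by have -> : mono n s = m by apply/mnmP => k; rewrite mnmE sk.
suff H k (a : {ffun 'I_n -> A}) :
    (forall i : 'I_n, (k <= i)%N -> exists l, a i = base l) -> g a = 0.
  by move=> a; apply: (H n) => i; rewrite leqNgt ltn_ord.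
elim: k a => [|k IH] a aP.
  have {}aP i : exists l, a i == base l by have [l ->] := aP i (leq0n _); exists l.
  rewrite -[RHS](gb [ffun i => xchoose (aP i)]); congr g; apply/ffunP => i.
  by rewrite !ffunE; apply/eqP/(xchooseP (aP i)).
case: (ltnP k n) => kn; last by apply: IH => i; rewrite leqNgt (leq_trans (ltn_ord i)).
rewrite -[a](upd_id a (Ordinal kn)) sesqui_expand // big1 // => l _.
rewrite IH ?mulr0 // => i ki; rewrite ffunE; case: eqP => [_|/eqP ik]; first by exists l.
by apply: aP; rewrite ltn_neqAle ki andbT; apply: contraNneq ik => ik; apply/eqP/val_inj.
Qed.

(** * The differential on Taylor coefficients *)

Section Differential.
Variables (n : nat) (g : precochain A n).
Hypothesis sg : sesqui g.

Definition ddterm (i j : 'I_n.+1) (a : {ffun 'I_n.+1 -> A}) : {mpoly K[n.+1]} :=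
  \sum_(k < size (sv_br (a i) (a j))) 'X_i ^+ k *
    (g (finfun (contract i j ((sv_br (a i) (a j))`_k : A) a)) \mPo ctuple K i j).

Lemma ddE a : dd g a = \sum_(i < n.+1) \sum_(j < n.+1 | (i < j)%N)
  (-1) ^+ (i + j) *: ddterm i j a.
Proof. by []. Qed.

(** By sesquilinearity ∂ acts on the bracket in the first slot as minus the
    variable of that slot, which is replaced by the sum of two variables. *)
Lemma ddterm_expand (i j : 'I_n.+1) a : (i < j)%N ->
  ddterm i j a = \sum_l pev2 (- ('X_i + 'X_j)) 'X_i (sv_coord (a i) (a j) l)
    * (g (finfun (contract i j (base l) a)) \mPo ctuple K i j).
Proof.
move=> ij; have [o o0 oE] := contract0P ij.
have updo (x y : A) :
    upd (finfun (contract i j x a)) o y = finfun (contract i j y a).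
  apply/ffunP => k; rewrite !ffunE; case: eqP => [->|/eqP ko]; first by rewrite oE.
  rewrite /contract; case: k ko => [[|k] kn] //=; rewrite -val_eqE /= o0 //.
transitivity (\sum_(k < size (sv_br (a i) (a j))) \sum_l 'X_i ^+ k *
    (pev (- ('X_i + 'X_j)) (sv_coord (a i) (a j) l)`_k
    * (g (finfun (contract i j (base l) a)) \mPo ctuple K i j))).
  apply: eq_bigr => k _; rewrite -mulr_sumr; congr (_ * _).
  rewrite -(updo 0 (_`_k)) sesqui_expand // rmorph_sum; apply: eq_bigr => l _ /=.
  rewrite rmorphM /= updo pev_comp rmorphN /= comp_mpolyXU -tnth_nth tnth_mktuple oE.
  by congr (pev _ _ * _); apply: sv_brE.
rewrite exchange_big; apply: eq_bigr => l _ /=.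
rewrite -(pev2_sum _ _ (sv_size_coord (a i) (a j) l)) mulr_suml.
by apply: eq_bigr => k _; rewrite mulrA.
Qed.

Lemma pev_Dx (i j : 'I_n.+1) : - ('X_i + 'X_j) + 'X_i = - 'X_j :> {mpoly K[n.+1]}.
Proof. by ring. Qed.

Lemma sesqui_ddterm (i j : 'I_n.+1) : (i < j)%N -> sesqui (ddterm i j).
Proof.
move=> ij a p f x y; rewrite !ddterm_expand // mulr_sumr -big_split.
apply: eq_bigr => l _ /=; rewrite !pev2_coord pev_Dx.
have ji : (j == i) = false by rewrite -val_eqE /= gtn_eqF.
have ij' : (i == j) = false by rewrite -val_eqE /= ltn_eqF.
have skipping (z w : A) : (p == i) || (p == j) ->
    contract i j z (upd a p w) =1 contract i j z a.
  move=> pij [[|k] kn] //; rewrite /contract /= upd_neq //.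
  have /andP[si sj] := skip_neq ij kn.
  by case/orP: pij => /eqP ->.
have cE (z w : A) : (p == i) || (p == j) ->
    finfun (contract i j z (upd a p w)) = finfun (contract i j z a).
  by move=> pij; apply/ffunP => k; rewrite !ffunE skipping.
have [pi|pi] := eqVneq p i.
  rewrite !cE ?pi ?eqxx // !updE !(upd_neq _ _ (negbT ji)) mulrA -mulrDl; congr (_ * _).
  rewrite mulr_sumr -big_split; apply: eq_bigr => u _ /=.
  rewrite mulr_sumr -big_split; apply: eq_bigr => v _ /=.
  by rewrite sv_combE rmorphD rmorphM /=; ring.
have [pj|pj] := eqVneq p j.
  rewrite !cE ?pj ?eqxx ?orbT // !updE !(upd_neq _ _ (negbT ij')) mulrA -mulrDl; congr (_ * _).
  rewrite mulr_sumr -big_split; apply: eq_bigr => u _ /=.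
  rewrite mulr_sumr -big_split; apply: eq_bigr => v _ /=.
  by rewrite sv_combE rmorphD rmorphM /=; ring.
rewrite ![upd a p _ i]upd_neq 1?eq_sym // ![upd a p _ j]upd_neq 1?eq_sym //.
rewrite mulrCA -mulrDr; congr (_ * _).
have [k kn pk] := skip_surj ij pi pj.
have cU (w : A) : finfun (contract i j (base l) (upd a p w))
    = upd (finfun (contract i j (base l) a)) (Ordinal kn) w.
  apply/ffunP => -[[|k'] kn']; rewrite !ffunE /contract /=; first by [].
  by rewrite ffunE -/(skip i j k') pk skip_inj // -val_eqE /=.
rewrite !cU sg rmorphD rmorphM /= pev_comp rmorphN /= comp_mpolyXU -tnth_nth tnth_mktuple.
by rewrite /contract /= -/(skip i j k) -pk.
Qed.

Lemma sesqui_dd : sesqui (dd g).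
Proof.
move=> a p f x y; rewrite !ddE mulr_sumr -big_split; apply: eq_bigr => i _ /=.
rewrite mulr_sumr -big_split; apply: eq_bigr => j ij /=.
by rewrite sesqui_ddterm // scalerDr scalerAr.
Qed.

Lemma pev2_base (D x : {mpoly K[n.+1]}) u v l :
  pev2 D x (sv_coord (base u) (base v) l) = pev2 D x (sv_table K u v 0 l).
Proof.
rewrite pev2_coord (bigD1 u) //= [X in _ + X]big1 => [|u' uu]; last first.
  apply: big1 => v' _; rewrite !mxE eqxx (negPf uu) rmorph0 !mul0r //.
rewrite addr0 (bigD1 v) //= [X in _ + X]big1 => [|v' vv]; last first.
  by rewrite !mxE !eqxx (negPf vv) rmorph0 mulr0 mul0r.
by rewrite addr0 !mxE !eqxx !rmorph1 !mul1r.
Qed.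

(** The variables multiplying the bracket lower one exponent, and the
    substitution adds the two exponents: this is the bracket of the letters. *)
Lemma taylor_ddterm (i j : 'I_n.+1) s (p := nth gen0 s i) (q := nth gen0 s j) :
    (i < j)%N -> size s = n.+1 ->
  taylor (mono n.+1 s) (ddterm i j (gens n.+1 s))
  = sv_coef K p q * coef g (sv_ind p q ::
      [seq nth gen0 s (bump j (bump i k)) | k <- iota 0 n.-1]).
Proof.
move=> ij ss.
set w := [seq _ | k <- _].
have [o o0 oE] := contract0P ij.
have n0 : (n = n.-1.+1)%N by move: (ltn_ord o); lia.
have sw : (size w).+1 = n by rewrite size_map size_iota.
have wE k : (k.+1 < n)%N -> nth gen0 w k = nth gen0 s (skip i j k).
  move=> kn; rewrite skipE // (nth_map 0%N) ?size_iota ?nth_iota ?add0n //; lia.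
pose t := sv_tgt p.1 q.1.
have gE e : finfun (contract i j (base t) (gens n.+1 s)) = gens n ((t, e) :: w).
  by apply/ffunP => -[[|k] kn]; rewrite !ffunE /contract //= -/(skip i j k) wE // gensE.
have coefE e : coef g ((t, e) :: w)
    = taylor (mono n ((t, e) :: w)) (g (gens n ((t, 0%N) :: w))).
  by rewrite /coef /= sw eqxx -gE (gE 0%N).
rewrite ddterm_expand // (bigD1 t) //= [X in _ + X]big1 ?addr0 => [|l lt]; last first.
  by rewrite !gensE pev2_base pev2_table (negPf lt) mul0r.
rewrite !gensE pev2_base pev2_table -/p -/q eqxx (gE 0%N) pev_Dx mulrN opprK.
set G := g _.
rewrite !mulrDl -!mulrA !mul_mpolyC !taylorD !taylorZ !taylor_X.
rewrite !taylor_contract // !mnmE -/p -/q.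
have cm0 : cmon i j (mono n.+1 s) = mono n ((t, p.2 + q.2)%N :: w).
  apply/mnmP => -[[|k] kn]; rewrite cmonE /contract /= !mnmE //=.
  by rewrite wE.
have cm1 u : u = i \/ u = j -> (mono n.+1 s) u != 0%N ->
    cmon i j (mono n.+1 s - U_(u)) = mono n ((t, (p.2 + q.2).-1)%N :: w).
  move=> uij mu; apply/mnmP => -[[|k] kn]; rewrite cmonE [RHS]mnmE /contract /= ?mnmBE ?mnm1E.
    have ji : (j == i) = false by rewrite -val_eqE /= gtn_eqF.
    have ij' : (i == j) = false by rewrite -val_eqE /= ltn_eqF.
    by case: uij mu => ->; rewrite !mnmE -/p -/q eqxx ?ji ?ij' /=; lia.
  rewrite -/(skip i j k) wE // mnmE.
  have /andP[/negPf si /negPf sj] := skip_neq ij kn.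
  by case: uij => ->; rewrite [_ == skip i j k]eq_sym ?si ?sj subn0.
have cmi : p.2%:R * taylor (cmon i j (mono n.+1 s - U_(i))) G
         = p.2%:R * coef g ((t, (p.2 + q.2).-1) :: w).
  have [->|pi] := eqVneq p.2 0%N; first by rewrite !mul0r.
  by rewrite coefE cm1 ?mnmE //; left.
have cmj : q.2%:R * taylor (cmon i j (mono n.+1 s - U_(j))) G
         = q.2%:R * coef g ((t, (p.2 + q.2).-1) :: w).
  have [->|qj] := eqVneq q.2 0%N; first by rewrite !mul0r.
  by rewrite coefE cm1 ?mnmE //; right.
rewrite cmi cmj cm0 -coefE /sv_coef /sv_ind -/t.
have [low|high] := boolP (sv_low p.1 q.1); first by rewrite sv_low_cst //; ring.
by rewrite !(sv_high_coef0, mul0r, add0r).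
Qed.

End Differential.
End Sesquilinear.

Section Coefficients.
Variable K : numFieldType.
Local Notation A := (extended_SV K).
Local Notation d := (differential (@sv_coef K) sv_ind).
Local Notation "∂" := (@partial K).

Lemma comp_perm_msym n (s : 'S_n) (p : {mpoly K[n]}) :
  p \mPo [tuple 'X_(s k) | k < n] = msym s p.
Proof.
rewrite /comp_mpoly /msym /mmap; apply: eq_bigr => m _; congr (_ * _).
by apply: mmap1_eq => k; rewrite tnth_mktuple.
Qed.

Lemma nth_cat_pair (T : Type) (x : T) s1 a b s2 l :
  nth x (s1 ++ a :: b :: s2) l = if (l == size s1)%N then a else
    if (l == (size s1).+1)%N then b else nth x (s1 ++ x :: x :: s2) l.
Proof. by elim: s1 l => [|y s1 IH] [|[|l]] //=; rewrite IH. Qed.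

(** Skew-symmetry under the transposition of two neighbours. *)
Lemma alternating_coef n (g : precochain A n) : is_cochain g -> alternating (coef g).
Proof.
case=> _ _ skew s1 a b s2; rewrite /coef !size_cat /=.
case: eqP => [sn|_]; last by rewrite oppr0.
set s := _ ++ _; set s' := s1 ++ b :: a :: s2.
have k1 : ((size s1).+1 < n)%N by rewrite -sn !addnS !ltnS leq_addr.
pose i := Ordinal (ltnW k1); pose j := Ordinal k1.
have sE (k : 'I_n) : nth gen0 s' k = nth gen0 s (tperm i j k).
  rewrite /s /s' nth_cat_pair [RHS]nth_cat_pair; case: tpermP => [->|->|/eqP ki /eqP kj] /=.
  - by rewrite !eqxx gtn_eqF.
  - by rewrite !eqxx gtn_eqF.
  - by move: ki kj; rewrite -!val_eqE /= => /negPf -> /negPf ->.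
have := skew (gens K n s) (tperm i j).
have -> : [ffun k => gens K n s (tperm i j k)] = gens K n s'.
  by apply/ffunP => k; rewrite !ffunE sE.
have ij : i != j by rewrite -val_eqE /= ltn_eqF.
rewrite comp_perm_msym odd_tperm ij expr1 scaleN1r.
move/(congr1 (mcoeff (mono n s))); rewrite mcoeff_sym mcoeffN => E.
rewrite /taylor -[(g _)@_(mono n s)]opprK -E.
have -> : [multinom mono n s (tperm i j k) | k < n] = mono n s'.
  by apply/mnmP => k; rewrite !mnmE sE.
rewrite mulNr; congr (- (_ * _%:R)).
rewrite [RHS](eq_bigr (fun k => (mono n s (tperm i j k))`!)) => [|k _].
  by rewrite (reindex_inj (@perm_inj _ (tperm i j))).
by rewrite !mnmE sE.
Qed.

Lemma cochain_coef n (g : precochain A n) : is_cochain g -> cochain 0 n (coef g).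
Proof.
move=> cg; split; first exact: alternating_coef.
  by move=> s; rewrite /coef addn0; case: (size s =P n) => // _; rewrite eqxx.
exists (\max_(t : {ffun 'I_n -> 'I_4}) msize (g [ffun k => base K (t k)])) => s.
rewrite /coef; case: (size s =P n) => [sn|]; last by rewrite eqxx.
rewrite /taylor mulf_eq0 negb_or => /andP[gs _].
apply/(all_nthP gen0) => k; rewrite sn => kn.
have -> : (nth gen0 s k).2 = mono n s (Ordinal kn) by rewrite mnmE.
apply: leq_ltn_trans (_ : mdeg (mono n s) < _)%N.
  by rewrite mdegE (bigD1 (Ordinal kn)) //= leq_addr.
apply: leq_trans (_ : msize (g (gens K n s)) <= _)%N.
  by apply: msize_mdeg_lt; rewrite mcoeff_msupp.
rewrite (bigmax_sup [ffun k => (nth gen0 s (k : 'I_n)).1]) //.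
rewrite (_ : gens K n s = [ffun l => base K ([ffun l : 'I_n => (nth gen0 s l).1] l)]) //.
by apply/ffunP => l; rewrite !ffunE.
Qed.

Lemma coef_dd n (g : precochain A n) s : is_cochain g -> coef (dd g) s = d (coef g) s.
Proof.
move=> cg; have aF := alternating_coef cg; rewrite {1}/coef.
case: (size s =P n.+1) => sn; last first.
  rewrite d_size // => t ts; rewrite /coef; case: eqP => // tn.
  by case: sn; rewrite -ts tn.
rewrite (d_sumE _ _ gen0) // sn ddE taylor_sum; apply: eq_bigr => i _.
rewrite taylor_sum; apply: eq_bigr => j ij.
by rewrite taylorZ taylor_ddterm // ; apply: is_cochain_sesqui.
Qed.

Lemma partial_sumE F s : ∂ F s = \sum_(i < size s)
  (nth gen0 s i).2%:R * F (set_nth gen0 s i ((nth gen0 s i).1, (nth gen0 s i).2.-1)).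
Proof.
elim: s F => [|[u e] s IH] F; first by rewrite big_ord0 /partial /= oppr0.
by rewrite partial_cons big_ord_recl /= IH.
Qed.

Lemma coef_del n (g : precochain A n) s : coef (del g) s = ∂ (coef g) s.
Proof.
rewrite {1}/coef; case: (size s =P n) => sn; last first.
  apply/esym/eqP; apply: contraT => /partial_neq0 [t + [ts _ _]].
  by rewrite /coef ts; case: (size s =P n) => // _; rewrite eqxx.
rewrite /del mulr_suml taylor_sum partial_sumE sn; apply: eq_bigr => i _.
rewrite taylor_X mnmE; set p := nth gen0 s i.
have [->|p0] := eqVneq p.2 0%N; first by rewrite !mul0r.
congr (_ * _); rewrite /coef size_set_nth sn (maxn_idPr (ltn_ord i)) eqxx.
congr taylor.
  apply/mnmP => k; rewrite mnmBE mnm1E !mnmE nth_set_nth /= val_eqE eq_sym.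
  by case: eqP => [->|_]; rewrite ?subn1 ?subn0.
congr g; apply/ffunP => k; rewrite !gensE nth_set_nth /= val_eqE.
by case: eqP => [->|].
Qed.

End Coefficients.

(** * From coefficient functions back to polynomial cochains *)

Section Realize.
Variables (K : numFieldType) (n D : nat) (F : seq gen -> K).
Local Notation A := (extended_SV K).
Local Notation index := {ffun 'I_n -> 'I_4 * 'I_D}.

Definition word (s : index) : seq gen :=
  [seq ((s k).1, val (s k).2) | k <- enum 'I_n].

Definition factor (s : index) (k : 'I_n) (y : A) : {mpoly K[n]} :=
  pev (- 'X_k) (y 0 (s k).1) * 'X_k ^+ (s k).2.

(** The inverse of [coef] on cochains: each word contributes its monomial,
    multiplied by the values of the coefficients of the arguments. Exponents are
    cut off at D to get a finite sum. *)
Definition realize : precochain A n := fun a =>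
  \sum_(s : index) (F (word s) / (\prod_k (s k).2`!)%:R) *: \prod_k factor s k (a k).

Lemma sesqui_realize : sesqui realize.
Proof.
move=> a i f x y; rewrite /realize mulr_sumr -big_split; apply: eq_bigr => s _ /=.
have E z : \prod_k factor s k (upd a i z k)
         = factor s i z * \prod_(k | k != i) factor s k (a k).
  rewrite (bigD1 i) //= updE; congr (_ * _).
  by apply: eq_bigr => k ki; rewrite upd_neq.
have FE : factor s i (f *: x + y) = pev (- 'X_i) f * factor s i x + factor s i y.
  by rewrite /factor sv_combE rmorphD rmorphM /=; ring.
by rewrite !E FE -!mul_mpolyC; ring.
Qed.

Lemma word_size s : size (word s) = n.
Proof. by rewrite size_map size_enum_ord. Qed.

Lemma nth_word s (k : 'I_n) : nth gen0 (word s) k = ((s k).1, val (s k).2).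
Proof. by rewrite (nth_map k) ?size_enum_ord // nth_ord_enum. Qed.

Lemma is_cochain_realize : alternating F -> is_cochain realize.
Proof.
move=> aF; apply: sesqui_is_cochain sesqui_realize _ => a s.
rewrite /realize rmorph_sum scaler_sumr /=.
pose act (t : index) : index := [ffun k => t (s k)].
have act_inj : injective act.
  move=> t t' /ffunP E; apply/ffunP => k.
  by have := E ((s^-1)%g k); rewrite !ffunE permKV.
rewrite (reindex_inj act_inj); apply: eq_bigr => t _ /=.
rewrite comp_mpolyZ scalerA; congr (_ *: _).
  have -> : F (word (act t)) = (-1) ^+ s * F (word t).
    rewrite -(alternating_permS aF (fun k => ((t k).1, val (t k).2))).
    by congr F; apply: eq_map => k; rewrite ffunE.
  rewrite -mulrA; congr (_ * (_ / _%:R)).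
  rewrite [RHS](reindex_inj (@perm_inj _ s)).
  by apply: eq_bigr => k _; rewrite ffunE.
rewrite rmorph_prod [RHS](reindex_inj (@perm_inj _ s)); apply: eq_bigr => k _ /=.
rewrite /factor rmorphM rmorphXn /= !ffunE pev_comp rmorphN /= comp_mpolyXU.
by rewrite -tnth_nth tnth_mktuple.
Qed.

Lemma coef_realize : cochain 0 n F ->
  (forall s, F s != 0 -> all (fun p : gen => p.2 < D)%N s) -> coef realize =1 F.
Proof.
move=> cF bF w; rewrite /coef; case: (size w =P n) => [wn|/eqP wn]; last first.
  by rewrite (cochain_size0 cF) ?addn0.
have fE (s : index) : \prod_k factor s k (gens K n w k)
    = [forall k, (s k).1 == (nth gen0 w k).1]%:R *: 'X_[[multinom (s k).2 : nat | k < n]].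
  rewrite mpolyXE_id /factor big_split /=.
  have -> : \prod_(k < n) 'X_k ^+ (s k).2
          = \prod_(k < n) 'X_k ^+ [multinom (s k).2 : nat | k < n] k :> {mpoly K[n]}.
    by apply: eq_bigr => k _; rewrite mnmE.
  rewrite -mul_mpolyC; congr (_ * _); case: forallP => [sw|/forallP].
    by rewrite big1 ?mpolyC1 // => k _; rewrite gensE !mxE (eqP (sw k)) !eqxx rmorph1.
  rewrite negb_forall => /existsP[k sk].
  by rewrite (bigD1 k) //= gensE mxE (negPf sk) andbF rmorph0 mul0r mpolyC0.
rewrite /realize taylor_sum.
under eq_bigr do rewrite taylorZ fE taylorZ /taylor mcoeffX.
have [wD|wD] := boolP (all (fun p : gen => p.2 < D)%N w); last first.
  have -> : F w = 0 by apply/eqP; apply: contraNT wD; apply: bF.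
  rewrite big1 // => s _; case: eqP => [/mnmP E|_]; last by rewrite mul0r !mulr0.
  case/negP: wD; apply/(all_nthP gen0) => k; rewrite wn => kn.
  by have := E (Ordinal kn); rewrite !mnmE /= => <-.
have wk (k : 'I_n) : ((nth gen0 w k).2 < D)%N.
  by move/(all_nthP gen0): wD; apply; rewrite wn.
pose s0 : index := [ffun k : 'I_n => ((nth gen0 w k).1, Ordinal (wk k))].
have s0w : word s0 = w.
  apply: (@eq_from_nth _ gen0); rewrite ?word_size // => k kn.
  by rewrite (nth_word s0 (Ordinal kn)) ffunE /=; case: nth.
rewrite (bigD1 s0) //= [X in _ + X]big1 ?addr0 => [|s ss0]; last first.
  case: forallP => [sw|]; last by rewrite mul0r mulr0.
  case: eqP => [/mnmP E|_]; last by rewrite mul0r !mulr0.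
  case/eqP: ss0; apply/ffunP => k; rewrite ffunE; move: (sw k) (E k); rewrite !mnmE.
  by case: (s k) => u e /= /eqP -> ew; congr (_, _); apply: val_inj.
have -> : [forall k : 'I_n, (s0 k).1 == (nth gen0 w k).1] by apply/forallP => k; rewrite ffunE.
have -> : [multinom (s0 k).2 : nat | k < n] = mono n w by apply/mnmP => k; rewrite !mnmE ffunE.
rewrite eqxx !mul1r s0w.
have -> : (\prod_k (s0 k).2`! = \prod_k (mono n w k)`!)%N.
  by apply: eq_bigr => k _; rewrite mnmE ffunE.
rewrite divfK // pnatr_eq0 -lt0n prodn_gt0 // => k; exact: fact_gt0.
Qed.

End Realize.

Lemma realize_cochain (K : numFieldType) n (F : seq gen -> K) : cochain 0 n F ->
  exists2 g : precochain (extended_SV K) n, is_cochain g & coef g =1 F.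
Proof.
move=> cF; have [aF _ [D bF]] := cF; exists (@realize K n D F).
  exact: is_cochain_realize.
exact: coef_realize.
Qed.

(** * The reduced cohomology *)

Section Dimension.
Variable K : numFieldType.
Local Notation A := (extended_SV K).
Local Notation d := (differential (@sv_coef K) sv_ind).
Local Notation wedge := (@wedge K gen).
Local Notation "∂" := (@partial K).

(** Both sides are sesquilinear, so that it suffices to compare Taylor
    coefficients. *)
Lemma del_eq n (g h : precochain A n) : sesqui g -> is_cochain h ->
  (forall s, coef g s = ∂ (coef h) s) -> g =1 del h.
Proof.
move=> sg ch E a; apply/eqP; rewrite -subr_eq0; apply/eqP.
have sh := sesqui_del (is_cochain_sesqui ch).
suff : -1 *: del h a + g a = 0 by rewrite scaleN1r addrC.
have sgh := sesqui_lin (-1) sh sg.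
apply: (sesqui_eq0 sgh) => s _.
by rewrite coef_lin coef_del E mulN1r addNr.
Qed.

(** As ∂ is injective in positive degrees and acts by zero on the unreduced
    cohomology, the long exact sequence splits: the reduced cohomology in degree
    q is the sum of the unreduced one in degree q and, through contraction with
    [gL 0], of the one in degree q + 1. *)
Definition reps (q : nat) : seq (seq gen -> K) :=
  map wedge (classes q) ++ map (ins (gL 0) \o wedge) (classes q.+1).

Lemma size_reps q : size (reps q) = (size (classes q) + size (classes q.+1))%N.
Proof. by rewrite size_cat !size_map. Qed.

Lemma nth_reps_l q i : (i < size (classes q))%N ->
  nth (fun=> 0) (reps q) i = wedge (nth [::] (classes q) i).
Proof. by move=> iq; rewrite nth_cat size_map iq (nth_map [::]). Qed.

Lemma nth_reps_r q i : (i < size (classes q.+1))%N ->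
  nth (fun=> 0) (reps q) (size (classes q) + i)
  = ins (gL 0) (wedge (nth [::] (classes q.+1) i)).
Proof.
by move=> iq; rewrite nth_cat size_map ltnNge leq_addr addKn /= (nth_map [::]).
Qed.

Lemma repsP q i : (i < size (reps q))%N -> exists2 h, cochain 0 q.+1 h &
  cochain 0 q (nth (fun=> 0) (reps q) i) /\
  forall s, d (nth (fun=> 0) (reps q) i) s = ∂ h s.
Proof.
rewrite size_reps => iq; case: (ltnP i (size (classes q))) => iC.
  have nS := mem_nth [::] iC; rewrite nth_reps_l //; set S := nth _ _ _ in nS *.
  exists (fun=> 0); first exact: cochain0.
  split; first by rewrite -(classes_size nS) -[size S]addn0; apply: cochain_wedge.
  by move=> s; rewrite (d_wedge _ _ nS) /partial theta0 oppr0.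
have iC' : (i - size (classes q) < size (classes q.+1))%N by rewrite ltn_subLR.
rewrite -(subnKC iC) nth_reps_r //.
have nS := mem_nth [::] iC'; set S := nth _ _ _ in nS *.
have cS : cochain 0 q.+1 (wedge S).
  by rewrite -(classes_size nS) -[size S]addn0; apply: cochain_wedge.
exists (wedge S) => //; split; first exact/cochain_pred/cochain_ins.
by move=> s; apply: d_ins_L0_wedge nS.
Qed.

Local Arguments classes : simpl never.

Lemma uniq_classes q : uniq (classes q).
Proof. by case: q => [|[|[|[|[|]]]]]. Qed.

Lemma sum_reps q (c : nat -> K) s :
  \sum_(i < size (reps q)) c i * nth (fun=> 0) (reps q) i s
  = \sum_(S <- classes q) c (index S (classes q)) * wedge S s
  + \sum_(S <- classes q.+1) c (size (classes q) + index S (classes q.+1))%N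
                              * ins (gL 0) (wedge S) s.
Proof.
rewrite -(big_mkord xpredT (fun i => c i * nth _ (reps q) i s)) size_reps.
rewrite (big_cat_nat (leq0n _) (leq_addr _ _)) /=; congr (_ + _).
  rewrite [RHS](big_nth [::]) !big_nat; apply: eq_bigr => i /= iq.
  by rewrite index_uniq ?uniq_classes // nth_reps_l.
have shift p r (G : nat -> K) :
    \sum_(p <= k < p + r) G k = \sum_(0 <= k < r) G (p + k)%N.
  by rewrite -{1}[p]add0n big_addn addKn; apply: eq_bigr => k _; rewrite addnC.
rewrite shift [RHS](big_nth [::]) !big_nat.
by apply: eq_bigr => i /= iq; rewrite index_uniq ?uniq_classes // nth_reps_r.
Qed.

Lemma cochain_succ n (F : seq gen -> K) : cochain 0 n F -> cochain 1 n.+1 F.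
Proof. by case=> aF sF bF; split=> // s /sF <-; rewrite addn0 addn1. Qed.

(** Reduced coboundaries in terms of coefficient functions, uniformly in the
    number of arguments. *)
Lemma reduced_coboundaryP q (z : precochain A q) : sesqui z ->
  reduced_coboundary z <->
  exists g g', [/\ cochain 1 q g, cochain 0 q g' & forall s, coef z s = d g s + ∂ g' s].
Proof.
case: q z => [|q] z sz /=.
  split=> [[h ch zh]|[g [g' [cg cg' E]]]].
    exists (fun=> 0), (coef h); split; [exact: cochain0|exact: cochain_coef|].
    move=> s; rewrite d0 add0r -coef_del /coef; congr (if _ then taylor _ _ else _).
    exact: zh.
  have [h ch hE] := realize_cochain cg'; exists h => //; apply: del_eq => // s.
  rewrite E (eq_partial hE) (eq_d _ _ (G := fun=> 0)) ?d0 ?add0r // => t.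
  by rewrite (cochain_size0 cg) // addn1.
split=> [[h ch [h' ch' zh]]|[g [g' [cg cg' E]]]].
  exists (coef h), (coef h'); split; [exact/cochain_succ/cochain_coef|exact: cochain_coef|].
  move=> s; rewrite -coef_del -coef_dd // /coef; case: eqP => _; last by rewrite addr0.
  by rewrite -taylorD -zh addrC subrK.
have [h ch hE] := realize_cochain (cochain_pred cg).
have [h' ch' hE'] := realize_cochain cg'.
exists h => //; exists h' => //; apply: del_eq => // [|s].
  exact: sesquiB sz (sesqui_dd (is_cochain_sesqui ch)).
rewrite (eq_partial hE') -[RHS](addKr (d g s)) -E addrC.
rewrite -(eq_d _ _ hE) -coef_dd // /coef; case: eqP => _; last by rewrite subr0.
by rewrite /taylor mcoeffB mulrBl.
Qed.

Theorem reduced_cohomology_reps q : reduced_cohomology_dim A q (size (reps q)).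
Proof.
have lift (i : 'I_(size (reps q))) : exists g : precochain A q,
    is_cochain g /\ coef g =1 nth (fun=> 0) (reps q) i.
  have [h _ [ci _]] := repsP (ltn_ord i).
  by have [g] := realize_cochain ci; exists g.
have [e eP] := fin_all_exists lift.
have se i : sesqui (e i) by have [ce _] := eP i; apply: is_cochain_sesqui.
have coef_comb (c : 'I_(size (reps q)) -> K) s :
    coef (fun a => \sum_i c i *: e i a) s = \sum_i c i * nth (fun=> 0) (reps q) i s.
  by rewrite coef_sum; apply: eq_bigr => i _; have [_ ->] := eP i.
exists e; split.
- move=> i; have [ce eE] := eP i; split=> //.
  have [h ch [_ hE]] := repsP (ltn_ord i).
  have [h' ch' hE'] := realize_cochain ch; exists h' => //.
  apply: del_eq => // [|s]; first exact: sesqui_dd.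
  by rewrite coef_dd // (eq_d _ _ eE) hE (eq_partial hE').
- move=> c /(reduced_coboundaryP (sesqui_sum _ _ se)) [g [g' [cg cg' E]]].
  pose c' (k : nat) := if insub k is Some i then c i else 0.
  have c'E (i : 'I_(size (reps q))) : c' i = c i by rewrite /c' valK.
  have [|a0 b0] := @classes_independent K q
    (fun S => c' (index S (classes q)))
    (fun S => c' (size (classes q) + index S (classes q.+1))%N) g g'
    (cochain_alternating cg) (cochain_alternating cg').
    move=> s; rewrite -sum_reps -E coef_comb.
    by apply: eq_bigr => i _; rewrite c'E.
  move=> i; rewrite -c'E; have := ltn_ord i; rewrite {2}size_reps.
  case: (ltnP i (size (classes q))) => iC iq.
    by have := a0 _ (mem_nth [::] iC); rewrite index_uniq ?uniq_classes.
  have iC' : (i - size (classes q) < size (classes q.+1))%N by rewrite ltn_subLR.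
  have := b0 _ (mem_nth [::] iC'); rewrite index_uniq ?uniq_classes //.
  by rewrite subnKC.
- move=> z [cz [h ch zh]].
  have [g [g' [a [b [cg cg' E]]]]] : exists g g' a b, [/\ cochain 1 q g, cochain 0 q g' &
      forall s, coef z s = \sum_(S <- classes q) a S * wedge S s
                  + \sum_(S <- classes q.+1) b S * ins (gL 0) (wedge S) s
                  + (d g s + ∂ g' s)].
    apply: (classes_spanning (h := coef h)); [exact: cochain_coef|exact: cochain_coef|].
    move=> s; rewrite -coef_dd // -coef_del /coef; congr (if _ then taylor _ _ else _).
    exact: zh.
  pose c' (k : nat) : K := if (k < size (classes q))%N then a (nth [::] (classes q) k)
    else b (nth [::] (classes q.+1) (k - size (classes q))).
  exists (fun i => c' i).
  have sz := is_cochain_sesqui cz.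
  apply/reduced_coboundaryP.
    exact: sesquiB sz (@sesqui_sum K q _ _ (fun i : 'I_(size (reps q)) => c' i) e se).
  exists g, g'; split=> // s.
  transitivity (coef z s - coef (fun p => \sum_(i < size (reps q)) c' i *: e i p) s).
    rewrite /coef; case: eqP => _; last by rewrite subr0.
    by rewrite /taylor mcoeffB mulrBl.
  rewrite coef_comb sum_reps E.
  have -> : \sum_(S <- classes q) a S * wedge S s
          = \sum_(S <- classes q) c' (index S (classes q)) * wedge S s.
    rewrite !big_seq; apply: eq_bigr => S qS.
    by rewrite /c' index_mem qS nth_index.
  have -> : \sum_(S <- classes q.+1) b S * ins (gL 0) (wedge S) s
          = \sum_(S <- classes q.+1) c' (size (classes q) + index S (classes q.+1))%N
                                      * ins (gL 0) (wedge S) s.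
    rewrite !big_seq; apply: eq_bigr => S qS.
    by rewrite /c' ltnNge leq_addr addKn /= nth_index.
  by rewrite addrC addKr.
Qed.

End Dimension.

Theorem theorem4p1 (R : realType) (q : nat) :
  reduced_cohomology_dim (extended_SV R[i]) q
    (match q with
     | 0 => 1
     | 2 => 3
     | 3 => 5
     | 4 => 2
     | _ => 0
     end)%N.
Proof.
have -> : (match q with 0 => 1 | 2 => 3 | 3 => 5 | 4 => 2 | _ => 0 end)%N
        = size (reps R[i] q) by case: q => [|[|[|[|[|q]]]]].
exact: reduced_cohomology_reps.
Qed.
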